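(* Let $N\ge2$, and let $p\in\left[\frac{N}{N-1},+\infty\right)$ and $q\in(1,N]$ be conjugate exponents, i.e. $\frac1p+\frac1q=1$. Let $\boldsymbol{A}\in\mathcal{DM}^p_{\rm loc}(\Omega)$, let $\lambda:\Omega\to[0,1]$ be a Borel function and let $E\subset\Omega$ be a Borel set. If $\chi_E\in BV^{\boldsymbol{A},\lambda}_{\rm loc}(\Omega)$, then $|(\boldsymbol{A},D\chi_E)_\lambda|(B)=0$ for every Borel set $B\subset\Omega$ which is $\sigma$-finite with respect to the measure $\mathscr{H}^{N-q}\llcorner\partial^-E$.
   Context: $\Omega\subset\mathbb{R}^N$ is a nonempty open set; $\mathscr{L}^N$ is Lebesgue measure, $\mathscr{H}^\alpha$ the $\alpha$-dimensional Hausdorff measure; $\mathcal{M}_{\rm loc}(\Omega)$ is the space of locally finite (signed) Radon measures on $\Omega$; $|\mu|$ is the total variation, $\mu\llcorner B$ the restriction. $\mathcal{DM}^p_{\rm loc}(\Omega)$ is the set of $\boldsymbol{A}\in L^p_{\rm loc}(\Omega;\mathbb{R}^N)$ with distributional divergence $\mathrm{div}\boldsymbol{A}\in\mathcal{M}_{\rm loc}(\Omega)$. For a Borel set $E$: $E^1$ is the set of points of Lebesgue density $1$ of $E$, $\partial^*E:=\mathbb{R}^N\setminus(E^1\cup(\mathbb{R}^N\setminus E)^1)$, $\partial^-E:=\{x\in\mathbb{R}^N:0<\mathscr{L}^N(E\cap B_r(x))<\mathscr{L}^N(B_r(x))\ \forall r>0\}$. The $\lambda$-representative of $\chi_E$ is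 $\chi_E^\lambda=\chi_{E^1}+\lambda\chi_{\partial^*E}$, and $$\langle(\boldsymbol{A},D\chi_E)_\lambda,\varphi\rangle:=-\int_\Omega\chi_E^\lambda\varphi\,d\,\mathrm{div}\boldsymbol{A}-\int_\Omega\chi_E\,\boldsymbol{A}\cdot\nabla\varphi\,dx,\qquad\varphi\in C_c^\infty(\Omega).$$ $\chi_E\in BV^{\boldsymbol{A},\lambda}_{\rm loc}(\Omega)$ means $(\boldsymbol{A},D\chi_E)_\lambda\in\mathcal{M}_{\rm loc}(\Omega)$. *)

(* Defs.v *)
From HB Require Import structures.
From mathcomp Require Import all_boot all_order all_algebra.
From mathcomp Require Import all_classical all_reals all_analysis.
From mathcomp Require Import measurable_realfun.
Set Implicit Arguments.
Unset Strict Implicit.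
Unset Printing Implicit Defensive.
Import Order.TTheory GRing.Theory Num.Theory.
Import numFieldNormedType.Exports.
Local Open Scope classical_set_scope.
Local Open Scope ring_scope.

(* The Borel sigma-algebra. *)
HB.instance Definition _ (R : realType) (m n : nat) :=
  Measurable.copy 'M[R]_(m, n) (g_sigma_algebraType (@open 'M[R]_(m, n))).

Section lebesgue_rV.
Variable R : realType.

Definition consrV n (z : R * 'rV[R]_n) : 'rV[R]_n.+1 :=
  \row_i (if unlift ord0 i is Some j then z.2 0 j else z.1).

Lemma open_measurable_rV n (U : set 'rV[R]_n) : open U -> measurable U.
Proof. by move=> oU; exact: sub_sigma_algebra. Qed.

Lemma consrVE n (x : R) (y : 'rV[R]_n) i :
  consrV (x, y) 0 i = if unlift ord0 i is Some j then y 0 j else x.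
Proof. by rewrite mxE. Qed.

Lemma ball_consrV n (x x' : R) (y y' : 'rV[R]_n) (e : R) :
  ball x e x' -> ball y e y' -> ball (consrV (x, y)) e (consrV (x', y')).
Proof.
move=> xx' [e0 yy']; split=> // i j; rewrite (ord1 i) !consrVE.
by case: unliftP => [k|] _ //; exact: yy'.
Qed.

Lemma rat_approx n (y : 'rV[R]_n) (e : R) : 0 < e ->
  exists c : 'rV[rat]_n, ball (map_mx ratr c : 'rV[R]_n) e y.
Proof.
move=> e0.
have h (i : 'I_n) : exists q : rat, `|ratr q - y 0 i| < e.
  have [|q] := @rat_in_itvoo R (y 0 i - e) (y 0 i + e).
    by rewrite ltrBlDr -addrA ltrDl addr_gt0.
  rewrite in_itv/= => /andP[h1 h2]; exists q.
  by rewrite ltr_norml ltrBrDr addrC h1/= ltrBlDl.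
exists (\row_i projT1 (cid (h i))); split=> // i j; rewrite (ord1 i) !mxE.
rewrite /ball/=; exact: (projT2 (cid (h j))).
Qed.

Lemma measurable_consrV n : measurable_fun setT (@consrV n).
Proof.
apply: (@measurability _ _ _ _ _ _ (@open 'rV[R]_n.+1)); first by [].
move=> _ [U oU <-]; rewrite setTI.
pose B (p : 'rV[rat]_1 * 'rV[rat]_n * nat) : set (R * 'rV[R]_n) :=
  ball (ratr (p.1.1 0 0) : R) (p.2.+1%:R^-1) `*`
  ball (map_mx ratr p.1.2 : 'rV[R]_n) (p.2.+1%:R^-1).
pose D := [set p | B p `<=` @consrV n @^-1` U].
rewrite (_ : _ @^-1` _ = \bigcup_p (if p \in D then B p else set0)); last first.
  apply/seteqP; split=> [[x y] Uxy|z [p _]]; last first.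
    by case: ifPn => // /set_mem; exact.
  have /nbhs_ballP[e /= e0 eU] : nbhs (consrV (x, y)) U by exact: open_nbhs_nbhs.
  have [k ke] : exists k, k.+1%:R^-1 < e / 2.
    have /ltr_add_invr[k] : 0 < e / 2 by rewrite divr_gt0.
    by rewrite add0r; exists k.
  have k0 : 0 < k.+1%:R^-1 :> R by rewrite invr_gt0.
  have [c yc] := rat_approx y k0.
  have [a xa] := rat_approx (const_mx x : 'rV_1) k0.
  have xa' : ball (ratr (a 0 0) : R) k.+1%:R^-1 x.
    by case: xa => _ /(_ 0 0); rewrite !mxE.
  exists (a, c, k) => //; rewrite ifT; first by split.
  apply/mem_set => -[x' y'] [/= xx' yy']; apply: eU.
  have kk : k.+1%:R^-1 + k.+1%:R^-1 <= e :> R.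
    by rewrite ltW// (splitr e) ltrD.
  apply: ball_consrV; apply: (le_ball kk).
    by apply: ball_triangle xx'; exact: ball_sym.
  by apply: ball_triangle yy'; exact: ball_sym.
apply: countable_bigcupT_measurable => // p.
case: ifP => // _; apply: measurableX; first exact: measurable_ball.
by apply: open_measurable_rV; exact: ball_open.
Qed.

(* The image of lebesgue_measure x m under R x R^n = R^(n+1). *)
Section step.
Variables (n : nat) (m : {sigma_finite_measure set 'rV[R]_n -> \bar R}).

Definition leb_step : set 'rV[R]_n.+1 -> \bar R :=
  pushforward (lebesgue_measure \x m)%E (@consrV n).

Let leb_step0 : leb_step set0 = 0%E.
Proof. by rewrite /leb_step /pushforward preimage_set0 measure0. Qed.

Let leb_step_ge0 A : (0 <= leb_step A)%E.
Proof. exact: integral_ge0. Qed.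

Let leb_step_sigma_additive : semi_sigma_additive leb_step.
Proof.
move=> F mF tF mUF; rewrite /leb_step /pushforward preimage_bigcup.
have mcons B : measurable B -> measurable (@consrV n @^-1` B).
  by move=> mB; rewrite -[X in measurable X]setTI; exact: measurable_consrV.
apply: measure_semi_sigma_additive.
- by move=> k; apply: mcons; exact: mF.
- apply/trivIsetP => /= i j _ _ ij; rewrite -preimage_setI.
  by move/trivIsetP : tF => /(_ _ _ _ _ ij) ->//; rewrite preimage_set0.
- by rewrite -preimage_bigcup; apply: mcons.
Qed.

HB.instance Definition _ := isMeasure.Build _ _ _ leb_step
  leb_step0 leb_step_ge0 leb_step_sigma_additive.

Let leb_step_sigma_finite : sigma_finite setT leb_step.
Proof.
have /sigma_finiteP[F [TF ndF Foo]] := sigma_finiteT m.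
have /sigma_finiteP[G [TG ndG Goo]] := sigma_finiteT (@lebesgue_measure R).
pose hd (v : 'rV[R]_n.+1) := v 0 0.
pose tl (v : 'rV[R]_n.+1) : 'rV[R]_n := \row_i v 0 (lift ord0 i).
have ctl : continuous tl.
  move=> v U /nbhs_ballP[e /= e0 eU]; apply/nbhs_ballP; exists e => // w vw.
  apply: eU; split=> // i j; rewrite !mxE.
  by case: vw => _; exact.
have mhd : measurable_fun setT hd.
  apply: (measurability _ (RGenOpens.measurableE R)).
  move=> _ [_ [a [b ->] <-]]; rewrite setTI; apply: open_measurable_rV.
  by apply: open_comp => [v _|]; [exact: coord_continuous|exact: interval_open].
have mtl : measurable_fun setT tl.
  apply: (measurability (@open 'rV[R]_n)) => // _ [U oU <-].
  rewrite setTI; apply: open_measurable_rV.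
  by apply: open_comp => // v _; exact: ctl.
have mhtI A B : measurable A -> measurable B ->
    measurable (hd @^-1` A `&` tl @^-1` B).
  move=> mA mB; have := mhd measurableT A mA; have := mtl measurableT B mB.
  by rewrite !setTI => mB' mA'; exact: measurableI.
exists (fun k => hd @^-1` G k `&` tl @^-1` F k).
  apply/esym; rewrite -subTset => v _.
  have [i _ Gi] : (\bigcup_i G i) (hd v) by rewrite -TG.
  have [j _ Fj] : (\bigcup_i F i) (tl v) by rewrite -TF.
  exists (maxn i j) => //; split.
    by have /subsetPset := ndG _ _ (leq_maxl i j); exact.
  by have /subsetPset := ndF _ _ (leq_maxr i j); exact.
move=> k; have [[mG Gk] [mF Fk]] := (Goo k, Foo k); split; first exact: mhtI.
rewrite /leb_step /pushforward (_ : _ @^-1` _ = G k `*` F k).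
  by rewrite product_measure1E// lte_mul_pinfty// ge0_fin_numE.
have hdE x y : hd (consrV (x, y)) = x by rewrite /hd consrVE unlift_none.
have tlE x y : tl (consrV (x, y)) = y.
  by apply/rowP => i; rewrite mxE consrVE liftK.
by apply/seteqP; split=> -[x y] /=; rewrite hdE tlE.
Qed.

HB.instance Definition _ :=
  Measure_isSigmaFinite.Build _ _ _ leb_step leb_step_sigma_finite.

End step.

(* N-dimensional Lebesgue measure on Borel sets, as an iterated product. *)
Fixpoint leb n : {sigma_finite_measure set 'rV[R]_n -> \bar R} :=
  if n is n'.+1 then leb_step (leb n') else dirac (0 : 'rV[R]_0).

End lebesgue_rV.
Arguments leb {R} n.

(* The norm, and hence the balls, of the library on 'rV[R]_N are those of the
   sup norm; geometric notions below use the Euclidean norm instead. *)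
Section euclidean.
Variables (R : realType) (N : nat).
Implicit Types (x y : 'rV[R]_N) (E : set 'rV[R]_N).

Definition edot x y : R := \sum_i x 0 i * y 0 i.
Definition enorm x : R := Num.sqrt (edot x x).
Definition eball x (r : R) : set 'rV[R]_N := [set y | enorm (x - y) < r].

Definition density1 E : set 'rV[R]_N :=
  [set x | fine (leb N (E `&` eball x r)) / fine (leb N (eball x r))
           @[r --> 0^'+] --> (1 : R)].

Definition ess_boundary E : set 'rV[R]_N :=
  ~` (density1 E `|` density1 (~` E)).

Definition minus_boundary E : set 'rV[R]_N :=
  [set x | forall r : R, 0 < r ->
    (0 < leb N (E `&` eball x r) < leb N (eball x r))%E].

Definition lambda_rep (lambda : 'rV[R]_N -> R) E x : R :=
  \1_(density1 E) x + lambda x * \1_(ess_boundary E) x.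

Definition diam E : \bar R :=
  ereal_sup [set (enorm (z.1 - z.2))%:E | z in E `*` E].

(* diam(E)^alpha, with the conventions diam(set0)^0 = 0 and 0^0 = 1
   otherwise, so that alpha = 0 gives the counting measure. *)
Definition diam_pow (alpha : R) E : \bar R :=
  if E == set0 then 0%E else (diam E `^ alpha)%E.

Definition hausdorff_premeasure (alpha delta : R) E : \bar R :=
  ereal_inf [set (\sum_(i <oo) diam_pow alpha (C i))%E |
    C in [set C : (set 'rV[R]_N)^nat |
      E `<=` \bigcup_i C i /\ forall i, (diam (C i) <= delta%:E)%E]].

(* No normalization constant: this is a positive multiple of the version
   normalized by omega_alpha / 2^alpha. *)
Definition hausdorff_measure (alpha : R) E : \bar R :=
  ereal_sup [set hausdorff_premeasure alpha delta E |
    delta in [set delta : R | 0 < delta]].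

Definition partial (i : 'I_N) (f : 'rV[R]_N -> R) : 'rV[R]_N -> R :=
  fun x => 'D_(delta_mx 0 i) f x.

Definition gradient (f : 'rV[R]_N -> R) x : 'rV[R]_N :=
  \row_i partial i f x.

Definition smooth (f : 'rV[R]_N -> R) := forall s : seq 'I_N,
  let g := foldr partial f s in
  continuous g /\ forall (i : 'I_N) x, derivable g x (delta_mx 0 i).

Variable Omega : set 'rV[R]_N.

Definition relatively_compact E := compact (closure E) /\ closure E `<=` Omega.

(* C_c^oo(Omega), as functions on R^N extended by zero. *)
Definition test_function (phi : 'rV[R]_N -> R) :=
  smooth phi /\ relatively_compact [set x | phi x != 0].

Definition Lp_loc (p : R) (A : 'rV[R]_N -> 'rV[R]_N) :=
  measurable_fun Omega A /\
  forall K, compact K -> K `<=` Omega ->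
    (\int[leb N]_(x in K) (enorm (A x) `^ p)%:E < +oo)%E.

End euclidean.

(* A locally finite signed measure on Omega need not be a charge on Omega: it
   is a set function on the relatively compact Borel subsets of Omega which is
   a finite signed measure on each compact subset of Omega. Its values on other
   sets are irrelevant. *)
Record sradon (R : realType) (N : nat) (Omega : set 'rV[R]_N) := Sradon {
  sradon_val :> set 'rV[R]_N -> \bar R ;
  sradonP : forall K, compact K -> K `<=` Omega ->
    exists nu : {charge set 'rV[R]_N -> \bar R},
      forall B, measurable B -> B `<=` K -> sradon_val B = nu B }.

Section sradon.
Variables (R : realType) (N : nat) (Omega : set 'rV[R]_N).
Implicit Types (mu : sradon Omega) (A B C : set 'rV[R]_N).
Local Open Scope ereal_scope.

Definition radon_variation mu B : \bar R :=
  ereal_sup [set \sum_(i <oo) `| mu (F i) | |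
    F in [set F : (set 'rV[R]_N)^nat |
      [/\ forall i, measurable (F i) /\ relatively_compact Omega (F i),
          trivIset setT F & B = \bigcup_i F i]]].

Lemma sradon_oppP mu K : compact K -> K `<=` Omega ->
  exists nu : {charge set 'rV[R]_N -> \bar R},
    forall B, measurable B -> B `<=` K -> - mu B = nu B.
Proof.
move=> cK KO; have [nu nuE] := sradonP mu cK KO.
by exists (copp nu) => B mB BK; rewrite (nuE B mB BK).
Qed.

Definition sradon_opp mu : sradon Omega := Sradon (sradon_oppP mu).

(* Jordan decomposition: mu = pos_variation mu - pos_variation (- mu). *)
Definition pos_variation mu B : \bar R :=
  ereal_sup [set mu C |
    C in [set C | [/\ measurable C, relatively_compact Omega C & C `<=` B]]].

Lemma sradon_relcompact mu C : relatively_compact Omega C ->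
  exists nu : {charge set 'rV[R]_N -> \bar R},
    forall B, measurable B -> B `<=` C -> mu B = nu B.
Proof.
move=> [cC CO]; have [nu nuE] := sradonP mu cC CO.
exists nu => B mB BC; apply: nuE => //.
exact: subset_trans (@subset_closure _ _).
Qed.

Lemma relatively_compactS A B : A `<=` B ->
  relatively_compact Omega B -> relatively_compact Omega A.
Proof.
move=> AB [cB BO]; have AB' := closureS AB; split.
  by apply: subclosed_compact cB AB'; exact: closed_closure.
exact: subset_trans AB' BO.
Qed.

Lemma relatively_compact0 : relatively_compact Omega set0.
Proof. by split; rewrite closure0//; exact: compact0. Qed.

Lemma relatively_compactU A B : relatively_compact Omega A ->
  relatively_compact Omega B -> relatively_compact Omega (A `|` B).
Proof.
move=> [cA AO] [cB BO]; split; rewrite closureU; first exact: compactU.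
by rewrite subUset.
Qed.

Lemma sradon0 mu : mu set0 = 0.
Proof.
have [nu nuE] := sradon_relcompact mu relatively_compact0.
by rewrite nuE ?charge0.
Qed.

Lemma sradon_fin_num mu C : measurable C -> relatively_compact Omega C ->
  mu C \is a fin_num.
Proof.
move=> mC /(sradon_relcompact mu)[nu nuE].
by rewrite nuE//; exact: fin_num_measure.
Qed.

Lemma pos_variation_ub mu B C : measurable C -> relatively_compact Omega C ->
  C `<=` B -> mu C <= pos_variation mu B.
Proof. by move=> mC rC CB; apply: ereal_sup_ubound; exists C. Qed.

Lemma pos_variation0 mu : pos_variation mu set0 = 0.
Proof.
apply/eqP; rewrite eq_le; apply/andP; split.
  apply: ge_ereal_sup => _ [C [_ _ +] <-].
  by rewrite subset0 => ->; rewrite sradon0.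
rewrite -(sradon0 mu); apply: pos_variation_ub => //.
exact: relatively_compact0.
Qed.

Lemma pos_variation_ge0 mu B : 0 <= pos_variation mu B.
Proof.
rewrite -(sradon0 mu); apply: pos_variation_ub => //.
exact: relatively_compact0.
Qed.

Lemma le_pos_variation mu A B : A `<=` B ->
  pos_variation mu A <= pos_variation mu B.
Proof.
move=> AB; apply: ge_ereal_sup => _ [C [mC rC CA] <-].
by apply: pos_variation_ub => //; exact: subset_trans AB.
Qed.

Lemma pos_variationU mu A B : A `&` B = set0 ->
  pos_variation mu A + pos_variation mu B <= pos_variation mu (A `|` B).
Proof.
move=> AB0; set u := pos_variation mu (A `|` B).
have [uoo|] := eqVneq u +oo; first by rewrite uoo leey.
rewrite -ltey => uoo.
have ufin : u \is a fin_num by rewrite ge0_fin_numE ?pos_variation_ge0.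
have CDu C D : measurable C -> relatively_compact Omega C -> C `<=` A ->
    measurable D -> relatively_compact Omega D -> D `<=` B -> mu C + mu D <= u.
  move=> mC rC CA mD rD DB.
  have rCD := relatively_compactU rC rD.
  have [nu nuE] := sradon_relcompact mu rCD.
  have -> : mu C + mu D = mu (C `|` D).
    rewrite !nuE//; [|exact: measurableU].
    rewrite chargeU//; by rewrite -subset0 -AB0; exact: setISS.
  apply: pos_variation_ub => //; first exact: measurableU.
  exact: setUSS.
have h1 D : measurable D -> relatively_compact Omega D -> D `<=` B ->
    pos_variation mu A <= u - mu D.
  move=> mD rD DB; apply: ge_ereal_sup => _ [C [mC rC CA] <-].
  by rewrite leeBrDr ?sradon_fin_num//; exact: CDu.
have Afin : pos_variation mu A \is a fin_num.
  rewrite ge0_fin_numE ?pos_variation_ge0//.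
  by rewrite (le_lt_trans _ uoo)// le_pos_variation.
rewrite addeC -leeBrDr//; apply: ge_ereal_sup => _ [D [mD rD DB] <-].
by rewrite leeBrDr// addeC -leeBrDr ?sradon_fin_num//; exact: h1.
Qed.

Let pos_variation_sigma_additive mu : semi_sigma_additive (pos_variation mu).
Proof.
move=> F mF tF mUF.
have cvgF : cvgn (fun n => \sum_(0 <= i < n) pos_variation mu (F i)).
  by apply: is_cvg_nneseries => *; exact: pos_variation_ge0.
suff <- : \sum_(i <oo) pos_variation mu (F i) =
    pos_variation mu (\bigcup_i F i).
  by [].
apply/eqP; rewrite eq_le; apply/andP; split.
  apply: lime_le => //; apply: nearW => n.
  have : \sum_(0 <= i < n) pos_variation mu (F i) <=
      pos_variation mu (\big[setU/set0]_(0 <= i < n) F i).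
    elim: n => [|n IH]; first by rewrite !big_nil pos_variation0.
    rewrite !big_nat_recr//=.
    apply: le_trans (pos_variationU _ _); first by rewrite leeD2r.
    rewrite big_mkord; apply: (@trivIset_bigsetUI _ predT F) => //.
    exact: sub_trivIset tF.
  move/le_trans; apply; apply: le_pos_variation.
  by rewrite big_mkord; exact: bigsetU_bigcup.
apply: ge_ereal_sup => _ [C [mC rC CF] <-].
have [nu nuE] := sradon_relcompact mu rC.
have mCF i : measurable (C `&` F i) by exact: measurableI.
have CE : C = \bigcup_i (C `&` F i).
  by rewrite -setI_bigcupr; exact/esym/setIidl.
have : (fun n => \sum_(0 <= i < n) nu (C `&` F i)) @ \oo --> nu C.
  rewrite [in nu C]CE; apply: charge_semi_sigma_additive => //.
    exact: trivIset_setIl.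
  by rewrite -CE.
move=> nuC; rewrite nuE// -(cvg_lim _ nuC)//.
apply: lee_lim => //; first by apply/cvg_ex; exists (nu C).
apply: nearW => n; apply: lee_sum => i _; rewrite -nuE//.
apply: pos_variation_ub => //.
by apply: relatively_compactS rC.
Qed.

HB.instance Definition _ mu := isMeasure.Build _ _ _ (pos_variation mu)
  (pos_variation0 mu) (pos_variation_ge0 mu)
  (@pos_variation_sigma_additive mu).

End sradon.

Section pairing.
Variables (R : realType) (N : nat) (Omega : set 'rV[R]_N).
Implicit Types (mu divA : sradon Omega).
Implicit Types (A : 'rV[R]_N -> 'rV[R]_N) (phi lambda : 'rV[R]_N -> R).

Definition sradon_integral mu (f : 'rV[R]_N -> R) : R :=
  \int[pos_variation mu]_(x in Omega) f x -
  \int[pos_variation (sradon_opp mu)]_(x in Omega) f x.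

Definition is_divergence A mu := forall phi, test_function Omega phi ->
  sradon_integral mu phi =
  - \int[leb N]_(x in Omega) edot (A x) (gradient phi x).

Definition DM_loc (p : R) A divA := Lp_loc Omega p A /\ is_divergence A divA.

Definition pairing A divA lambda (E : set 'rV[R]_N) phi : R :=
  - sradon_integral divA (fun x => lambda_rep lambda E x * phi x)
  - \int[leb N]_(x in Omega) (\1_E x * edot (A x) (gradient phi x)).

(* chi_E is in BV^(A, lambda)_loc(Omega) when such a mu exists; mu is then the
   measure (A, D chi_E)_lambda, and it is unique on relatively compact Borel
   sets. *)
Definition is_pairing_measure A divA lambda E mu :=
  forall phi, test_function Omega phi ->
    pairing A divA lambda E phi = sradon_integral mu phi.

End pairing.

(* Main.v *)
(** Proof idea.  By the hypothesis on the pairing, both A and chi_E A have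
    measure divergence, and the pairing is div(chi_E A) - chi_E^lambda div A.
    Let K be compact with finite H^(N-q)-measure, cover it by small balls
    B(x_i, r_i) with sum r_i^(N-q) <= M, and let f be a smooth cutoff equal to 1
    on the balls and supported in V = U B(x_i, 2 r_i).  One can arrange
    |grad f|^q <= C sum_i r_i^(-q) 1_B(x_i, 2 r_i), so that the L^q norm of
    grad f stays bounded while the L^p norm of A on V tends to 0, as K is
    Lebesgue-null.  Hence int A . grad f -> 0 while f -> 1_K, which kills div A
    and then the pairing on K; inner regularity extends this to Borel sets.
    Away from the boundary, E is locally null or of full measure, and the
    pairing vanishes on test functions. *)

From HB Require Import structures.
Require Import Defs.
From mathcomp Require Import all_boot all_order all_algebra.
From mathcomp Require Import all_classical all_reals all_analysis.
From mathcomp Require Import measurable_realfun.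
From mathcomp Require Import ring lra.
Set Implicit Arguments.
Unset Strict Implicit.
Unset Printing Implicit Defensive.
Import Order.TTheory GRing.Theory Num.Theory.
Import numFieldNormedType.Exports.
Local Open Scope classical_set_scope.
Local Open Scope ring_scope.

(** * Smooth cutoff functions *)

(** The covering balls overlap without control, and a maximum of bumps would not be smooth. The
    cutoff is therefore a smooth function of the sum of the bumps that saturates once this sum
    reaches 1. A bump [b] at scale r satisfies |grad b| <= C b^(1/p) / r, because the derivative of
    e^(-1/t) is at most a multiple of its own power 1/p. Young's inequality |A| b^(1/p) / r <= t^p
    |A|^p b + t^(-q) r^(-q) can then be summed: the multiplicity of the cover enters the first term
    only through the sum of the bumps, which is below 1 wherever the gradient of the cutoff is
    nonzero. The parameter t, chosen before the cover is refined, makes the second term small, and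
    refinement does the same for the first. A second obstacle is the sign: vanishing on one set may
    come from cancellation. Vanishing is therefore proved on all compact subsets and transferred to
    both Jordan parts, which are measures and can be split and summed. *)

Section flat_exponential.
Variable R : realType.
Implicit Types (s t : R) (k m : nat).

(** The functions t^(-k) e^(-1/t), extended by 0, have derivatives that are linear combinations of
    the same family, so first derivatives alone give smoothness of the case k = 0. *)
Definition gexp k t : R := if 0 < t then t ^- k * expR (- t^-1) else 0.

(** This is e^(s/m) >= s/m raised to the power m; for m = 0 the bound is 0^0 = 1. *)
Lemma exprX_expRN_le m s : 0 <= s -> s ^+ m * expR (- s) <= m%:R ^+ m.
Proof.
move=> s0; case: m => [|m].
  by rewrite !expr0 mul1r -expR0 ler_expR lerNl oppr0.
have m0 : 0 < m.+1%:R :> R by [].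
rewrite expRN ler_pdivrMr ?expR_gt0//.
have -> : expR s = expR (s / m.+1%:R) ^+ m.+1.
  by rewrite -expRM_natl mulrC divfK ?gt_eqF.
rewrite -exprMn lerXn2r ?nnegrE ?mulr_ge0 ?expR_ge0//.
rewrite mulrC -ler_pdivrMr//.
by apply: le_trans (expR_ge1Dx _); rewrite lerDr.
Qed.

Lemma gexp_gt0 k t : 0 < t -> 0 < gexp k t.
Proof. by move=> t0; rewrite /gexp t0 mulr_gt0 ?expR_gt0// invr_gt0 exprn_gt0. Qed.

Lemma gexp_le0 k t : t <= 0 -> gexp k t = 0.
Proof. by rewrite /gexp ltNge => ->. Qed.

Lemma gexp_ge0 k t : 0 <= gexp k t.
Proof.
by case: (ltP 0 t) => [/(gexp_gt0 k)/ltW //|/(gexp_le0 k) ->].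
Qed.

(** Put s = 1/t in s^(k+m) e^(-s). The case m = 2 gives the derivative at 0, the case m = 0 gives
    boundedness. *)
Lemma gexp_ub k m t : 0 < t -> gexp k t <= (k + m)%:R ^+ (k + m) * t ^+ m.
Proof.
move=> t0; rewrite /gexp t0 -ler_pdivrMr ?exprn_gt0//.
have -> : t ^- k * expR (- t^-1) / t ^+ m = t^-1 ^+ (k + m) * expR (- t^-1).
  by rewrite -exprVn -[(t ^+ m)^-1]exprVn exprD; ring.
by rewrite exprX_expRN_le// invr_ge0 ltW.
Qed.

Lemma is_derive_gexp k t :
  is_derive t (1 : R) (gexp k) (gexp k.+2 t - k%:R * gexp k.+1 t).
Proof.
have [t0|t0|t0] := ltgtP t 0.
- rewrite !gexp_le0 ?(ltW t0)// mulr0 subr0.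
  apply: (near_eq_is_derive _ (is_derive_cst (0 : R) t 1)).
  near=> x; rewrite gexp_le0// ltW//; near: x; exact: lt_nbhsl.
- have t1 : t != 0 by rewrite gt_eqF.
  suff h : is_derive t 1 (fun x : R => (x ^+ k)^-1 * expR (- x^-1))
      (gexp k.+2 t - k%:R * gexp k.+1 t).
    apply: near_eq_is_derive h; near=> x; rewrite /gexp ifT//; near: x;
      exact: lt_nbhsr.
  have h1 : is_derive t 1 (fun x : R => x^-1) (- t ^- 2 *: 1).
    exact: is_deriveV.
  have h2 : is_derive t 1 (fun x : R => expR (- x^-1)) (expR (- t^-1) * t ^- 2).
    apply: (@is_derive1_comp _ expR (fun x => - x^-1)).
    by rewrite -[X in is_derive _ _ _ X]opprK -[t ^- 2]mulr1 -mulNr;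
      exact: is_deriveN.
  have h3 : is_derive t 1 (fun x : R => (x ^+ k)^-1)
      (- (t ^+ k) ^- 2 *: ((k%:R * t ^+ k.-1) *: 1)).
    apply: (@is_deriveV _ (fun x : R => x ^+ k)).
      by rewrite expf_eq0 (negbTE t1) andbF.
    have := @is_deriveX _ _ (@id R) k t 1 1 (is_derive_id _ _).
    rewrite (_ : id ^+ k = (fun x : R => x ^+ k))//.
    apply/funext => x; elim: k => [|k IH]; rewrite ?expr0// !exprS.
    by rewrite -IH.
  apply: (is_derive_eq (is_deriveM h3 h2)).
  rewrite /gexp t0 /GRing.scale /= !mulr1.
  case: k {h3} => [|k]; first by rewrite !expr0 invr1; field.
  by rewrite [k.+1.-1]/= !exprS; field; rewrite t1 expf_neq0.
subst t; rewrite !gexp_le0// mulr0 subr0.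
(* At 0 the bound [gexp_ub] with exponent 2 makes the difference quotient at most a constant times
   |h|. *)
have h : h^-1 *: ((gexp k \o shift 0) (h *: 1) - gexp k 0) @[h --> 0^'] --> (0 : R).
  rewrite [gexp k 0]gexp_le0//.
  apply/cvgr0Pnorm_lt => e e0.
  pose C : R := (k + 2)%:R ^+ (k + 2) + 1.
  have C0 : 0 < C by rewrite ltr_wpDl// exprn_ge0.
  near=> x.
  have xn0 : x != 0 by near: x; exact: nbhs_dnbhs_neq.
  have xe : `|x| < e / C.
    near: x; apply: dnbhs0_lt; exact: divr_gt0.
  rewrite /= subr0 addr0 [_ *: 1]mulr1 normrZ normfV.
  have [x0|x0] := lerP x 0; first by rewrite gexp_le0// normr0 mulr0.
  rewrite (gtr0_norm x0) ger0_norm ?gexp_ge0//.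
  rewrite mulrC ltr_pdivrMr//.
  apply: (le_lt_trans (gexp_ub k 2 x0)).
  rewrite expr2 mulrA ltr_pM2r//.
  apply: (@le_lt_trans _ _ (C * x)); first by rewrite ler_wpM2r ?(ltW x0)// lerDl.
  by rewrite mulrC -ltr_pdivlMr// -(gtr0_norm x0).
by split; [apply/cvg_ex; exists 0 | exact: cvg_lim h].
Unshelve. all: by end_near. Qed.

Lemma derivable_gexp k t : derivable (gexp k) t 1.
Proof. by have [] := is_derive_gexp k t. Qed.

Lemma derive_gexp k t : 'D_1 (gexp k) t = gexp k.+2 t - k%:R * gexp k.+1 t.
Proof. by have [] := is_derive_gexp k t. Qed.

Lemma gexp0_homo s t : s <= t -> gexp 0 s <= gexp 0 t.
Proof.
move=> st; case: (ltP 0 s) => s0; last by rewrite gexp_le0// gexp_ge0.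
have t0 := lt_le_trans s0 st.
by rewrite /gexp s0 t0 !expr0 invr1 !mul1r ler_expR lerN2 lef_pV2// ?posrE.
Qed.

(** Since 1/p + 1/q = 1, e^(-1/t) splits as e^(-1/(qt)) times e^(-1/(pt)). The first factor absorbs
    t^(-2), because s^2 e^(-s) <= 4 at s = 1/(qt); the second is the power 1/p of the flat
    exponential. As [gexp 2] is the derivative of [gexp 0], this is what makes Young's inequality
    summable over bumps. *)
Lemma gexp2_le (p q : R) t : 0 < q -> p^-1 + q^-1 = 1 ->
  gexp 2 t <= 4 * q ^+ 2 * gexp 0 t `^ p^-1.
Proof.
move=> q0 pq; case: (ltP 0 t) => t0; last first.
  by rewrite gexp_le0// mulr_ge0 ?powR_ge0// mulr_ge0 ?sqr_ge0.
have qt : 0 <= (q * t)^-1 by rewrite invr_ge0 mulr_ge0// ltW.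
have t1 : t != 0 by rewrite gt_eqF.
have q1 : q != 0 by rewrite gt_eqF.
have p1 : p^-1 = 1 - q^-1 by rewrite -pq addrK.
have -> : gexp 2 t = q ^+ 2 * ((q * t)^-1 ^+ 2 * expR (- (q * t)^-1)) *
    gexp 0 t `^ p^-1.
  rewrite /gexp t0 expr0 invr1 mul1r -expRM p1.
  have -> : - t^-1 * (1 - q^-1) = - t^-1 + (q * t)^-1 by field; rewrite t1.
  rewrite expRD [expR (- (q * t)^-1)]expRN; field.
  by rewrite t1 q1 gt_eqF ?expR_gt0.
rewrite ler_wpM2r ?powR_ge0// mulrC ler_wpM2r ?sqr_ge0//.
apply: (le_trans (exprX_expRN_le 2 qt)); rewrite expr2; lra.
Qed.

End flat_exponential.

Section elementary_functions.
Variables (R : realType) (N : nat).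
Implicit Types (f g : 'rV[R]_N -> R) (i : 'I_N).

(* A class of smooth functions closed under partial derivatives by
   construction: it avoids any general Leibniz or Faa di Bruno formula. *)
Inductive elementary : ('rV[R]_N -> R) -> Prop :=
| elementary_cst c : elementary (fun=> c)
| elementary_coord i : elementary (fun x => x 0 i)
| elementaryD f g : elementary f -> elementary g ->
    elementary (fun x => f x + g x)
| elementaryM f g : elementary f -> elementary g ->
    elementary (fun x => f x * g x)
| elementary_gexp k f : elementary f -> elementary (fun x => gexp k (f x)).

Lemma elementary_differentiable f x : elementary f -> differentiable f x.
Proof.
elim=> {f} [c|i|f g _ df _ dg|f g _ df _ dg|k f _ df].
- exact: differentiable_cst.
- exact: differentiable_coord.
- exact: differentiableD.
- exact: differentiableM.
- apply: (@differentiable_comp _ _ _ _ f (gexp k)) => //.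
  by apply/derivable1_diffP; exact: derivable_gexp.
Qed.

Lemma partialD i f g x : differentiable f x -> differentiable g x ->
  partial i (fun x => f x + g x) x = partial i f x + partial i g x.
Proof. by move=> df dg; apply: deriveD; exact: diff_derivable. Qed.

Lemma partialM i f g x : differentiable f x -> differentiable g x ->
  partial i (fun x => f x * g x) x = f x * partial i g x + g x * partial i f x.
Proof. by move=> df dg; apply: deriveM; exact: diff_derivable. Qed.

Lemma partial_coord i j x :
  partial i (fun x : 'rV[R]_N => x 0 j) x = (j == i)%:R.
Proof.
rewrite /partial deriveE; last exact: differentiable_coord.
have lf : linear (fun v : 'rV[R]_N => v 0 j) by move=> a u v; rewrite !mxE.
pose l : {linear 'rV[R]_N -> R} := HB.pack (fun v : 'rV[R]_N => v 0 j)
  (GRing.isLinear.Build _ _ _ _ _ lf).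
have -> : (fun v : 'rV[R]_N => v 0 j) = l by [].
rewrite diff_lin; last exact: coord_continuous.
by rewrite /= mxE eqxx.
Qed.

Lemma partial_cst i c x : partial i (fun=> c) x = 0 :> R.
Proof. exact: derive_cst. Qed.

Lemma partial_gexp i k f x : differentiable f x ->
  partial i (fun x => gexp k (f x)) x =
  (gexp k.+2 (f x) - k%:R * gexp k.+1 (f x)) * partial i f x.
Proof.
move=> df; have dk : differentiable (gexp k) (f x).
  by apply/derivable1_diffP; exact: derivable_gexp.
rewrite /partial [LHS]deriveE;
  last exact: (@differentiable_comp _ _ _ _ f (gexp k)).
rewrite diff_comp// /= deriv1E; last exact: derivable_gexp.
by rewrite derive1E derive_gexp deriveE// [RHS]mulrC.
Qed.

Lemma elementary_partial i f : elementary f -> elementary (partial i f).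
Proof.
have dif := elementary_differentiable.
elim=> [c|j|{}f g ef pf eg pg|{}f g ef pf eg pg|k {}f ef pf].
- rewrite (_ : partial _ _ = (fun=> 0)); first exact: elementary_cst.
  by apply/funext => x; exact: partial_cst.
- rewrite (_ : partial _ _ = (fun=> (j == i)%:R)); first exact: elementary_cst.
  by apply/funext => x; exact: partial_coord.
- rewrite (_ : partial _ _ = (fun x => partial i f x + partial i g x)).
    exact: elementaryD.
  by apply/funext => x; apply: partialD; exact: dif.
- rewrite (_ : partial _ _ =
      (fun x => f x * partial i g x + g x * partial i f x)).
    by apply: elementaryD; exact: elementaryM.
  by apply/funext => x; apply: partialM; exact: dif.
- rewrite (_ : partial _ _ = (fun x =>
      (gexp k.+2 (f x) + (- k%:R) * gexp k.+1 (f x)) * partial i f x)).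
    apply: elementaryM => //; apply: elementaryD; first exact: elementary_gexp.
    by apply: elementaryM; [exact: elementary_cst|exact: elementary_gexp].
  by apply/funext => x; rewrite partial_gexp ?mulNr//; exact: dif.
Qed.

Lemma elementary_smooth f : elementary f -> smooth f.
Proof.
move=> ef s /=; suff es : elementary (foldr (@partial R N) f s).
  split=> [x|i x].
    exact/differentiable_continuous/elementary_differentiable.
  exact/diff_derivable/elementary_differentiable.
by elim: s => //= i s; exact: elementary_partial.
Qed.

Lemma elementary_sum (I : Type) (s : seq I) (F : I -> 'rV[R]_N -> R) :
  (forall j, elementary (F j)) -> elementary (fun x => \sum_(j <- s) F j x).
Proof.
move=> eF; elim: s => [|a s IH].
  rewrite (_ : (fun _ => _) = (fun=> 0)); first exact: elementary_cst.
  by apply/funext => x; rewrite big_nil.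
rewrite (_ : (fun _ => _) = (fun x => F a x + \sum_(j <- s) F j x)).
  exact: elementaryD.
by apply/funext => x; rewrite big_cons.
Qed.

Lemma partial_sum i (I : Type) (s : seq I) (F : I -> 'rV[R]_N -> R) x :
  (forall j, differentiable (F j) x) ->
  partial i (fun x => \sum_(j <- s) F j x) x = \sum_(j <- s) partial i (F j) x.
Proof.
move=> dF; suff [] : differentiable (fun x => \sum_(j <- s) F j x) x /\
  partial i (fun x => \sum_(j <- s) F j x) x
    = \sum_(j <- s) partial i (F j) x by [].
elim: s => [|a s [ds IH]].
  rewrite big_nil (_ : (fun _ => _) = (fun=> 0)).
    by split; [exact: differentiable_cst|exact: partial_cst].
  by apply/funext => y; rewrite big_nil.
rewrite big_cons (_ : (fun _ => _) = (fun x => F a x + \sum_(j <- s) F j x)).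
  by split; [exact: differentiableD|rewrite partialD// IH].
by apply/funext => y; rewrite big_cons.
Qed.

End elementary_functions.

Section euclidean_norm.
Variables (R : realType) (N : nat).
Implicit Types (x y : 'rV[R]_N) (r : R).

Lemma edotxx_ge0 x : 0 <= edot x x.
Proof. by apply: sumr_ge0 => i _; rewrite -expr2 sqr_ge0. Qed.

Lemma enorm_ge0 x : 0 <= enorm x.
Proof. exact: sqrtr_ge0. Qed.

Lemma sqr_enorm x : enorm x ^+ 2 = edot x x.
Proof. by rewrite sqr_sqrtr// edotxx_ge0. Qed.

Lemma ler_coord_enorm x i : `|x 0 i| <= enorm x.
Proof.
rewrite -sqrtr_sqr ler_wsqrtr// expr2 /edot (bigD1 i)//= lerDl.
by apply: sumr_ge0 => j _; rewrite -expr2 sqr_ge0.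
Qed.

Lemma ler_norm_enorm x : `|x| <= enorm x.
Proof.
have [->|x0] := eqVneq x 0; first by rewrite normr0 enorm_ge0.
have /mx_norm_neq0[[i j] /= xE] : mx_norm x != 0.
  by rewrite -[mx_norm x]/`|x| normr_eq0.
by rewrite -[`|x|]/(mx_norm x) xE ord1 ler_coord_enorm.
Qed.

Lemma enorm0 : enorm (0 : 'rV[R]_N) = 0.
Proof. by rewrite /enorm /edot big1 ?sqrtr0// => i _; rewrite mxE mulr0. Qed.

Lemma enorm_sub_ltE x y r : 0 < r ->
  (enorm (x - y) < r) = (edot (x - y) (x - y) < r ^+ 2).
Proof.
by move=> r0; rewrite -sqr_enorm ltr_sqr ?nnegrE ?enorm_ge0// ltW.
Qed.

Lemma ler_norm_edot x y (M : R) : (forall i, `|y 0 i| <= M) ->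
  `|edot x y| <= N%:R * enorm x * M.
Proof.
move=> yM; apply: (le_trans (ler_norm_sum _ _ _)).
apply: (@le_trans _ _ (\sum_(i < N) enorm x * M)).
  by apply: ler_sum => i _; rewrite normrM ler_pM// ler_coord_enorm.
by rewrite sumr_const card_ord -mulrA mulr_natl.
Qed.

Lemma eball_center x r : 0 < r -> eball x r x.
Proof. by rewrite /eball/= subrr enorm0. Qed.

Lemma eball_sub_ball x r : eball x r `<=` ball x r.
Proof.
move=> y xy; rewrite -ball_normE /=; apply: le_lt_trans xy.
exact: ler_norm_enorm.
Qed.

End euclidean_norm.

Section cutoff.
Variables (R : realType) (N : nat).
Implicit Types (x y a : 'rV[R]_N) (z : 'rV[R]_N * R) (s : seq ('rV[R]_N * R)).

(** Positive exactly on the doubled ball and at least 3 on the ball itself, whence the normalization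
    of [bump] by [gexp 0 3]. The squared norm keeps it polynomial. *)
Definition bump_arg z x : R := 4 + - z.2 ^- 2 * edot (z.1 - x) (z.1 - x).

Definition bump z x : R := gexp 0 (bump_arg z x) * (gexp 0 (3 : R))^-1.

Definition bump_sum s x : R := \sum_(z <- s) bump z x.

(** A smooth substitute for the minimum of 1 and the sum of the bumps: it is 0 where the sum is 0
    and 1 where the sum is at least 1. The form [1 + -1 * _] follows the constructors of
    [elementary]. *)
Definition cutoff s x : R :=
  1 + - (gexp 0 (1 : R))^-1 * gexp 0 (1 + -1 * bump_sum s x).

Definition doubled s : set 'rV[R]_N :=
  \bigcup_(z in [set z | z \in s]) eball z.1 (2 * z.2).

Lemma bump_ge0 z x : 0 <= bump z x.
Proof. by rewrite mulr_ge0 ?invr_ge0 ?gexp_ge0. Qed.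

Lemma bump_sum_ge0 s x : 0 <= bump_sum s x.
Proof. by apply: sumr_ge0 => z _; exact: bump_ge0. Qed.

Lemma bump_arg_gt0 z x : 0 < z.2 ->
  (0 < bump_arg z x) = (enorm (z.1 - x) < 2 * z.2).
Proof.
move=> z0; rewrite enorm_sub_ltE ?mulr_gt0// /bump_arg mulNr subr_gt0.
by rewrite mulrC ltr_pdivrMr ?exprn_gt0// exprMn -natrX.
Qed.

Lemma bump_ge1 z x : 0 < z.2 -> eball z.1 z.2 x -> 1 <= bump z x.
Proof.
move=> z0; rewrite /eball/= enorm_sub_ltE// => zx.
rewrite /bump ler_pdivlMr ?gexp_gt0// mul1r gexp0_homo// /bump_arg mulNr.
rewrite lerBrDr -lerBrDl (_ : 4 - 3 = 1 :> R); last by lra.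
by rewrite mulrC ler_pdivrMr ?exprn_gt0// mul1r ltW.
Qed.

Lemma bump_eq0 z x : 0 < z.2 -> ~ eball z.1 (2 * z.2) x -> bump z x = 0.
Proof.
move=> z0 /negP; rewrite -bump_arg_gt0// -leNgt => u0.
by rewrite /bump gexp_le0// mul0r.
Qed.

Lemma elementary_bump_arg z : elementary (bump_arg z).
Proof.
apply: elementaryD; first exact: elementary_cst.
apply: elementaryM; first exact: elementary_cst.
have e j : elementary (fun x => (z.1 - x) 0 j).
  rewrite (_ : (fun _ => _) = (fun x => z.1 0 j + -1 * x 0 j)).
    apply: elementaryD; first exact: elementary_cst.
    by apply: elementaryM; [exact: elementary_cst|exact: elementary_coord].
  by apply/funext => x; rewrite !mxE mulN1r.
by apply: elementary_sum => j; apply: elementaryM; exact: e.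
Qed.

Lemma elementary_bump z : elementary (bump z).
Proof.
apply: elementaryM; last exact: elementary_cst.
exact/elementary_gexp/elementary_bump_arg.
Qed.

Lemma elementary_bump_sum s : elementary (bump_sum s).
Proof. by apply: elementary_sum => z; exact: elementary_bump. Qed.

Lemma elementary_cutoff s : elementary (cutoff s).
Proof.
apply: elementaryD; first exact: elementary_cst.
apply: elementaryM; first exact: elementary_cst.
apply: elementary_gexp; apply: elementaryD; first exact: elementary_cst.
by apply: elementaryM; [exact: elementary_cst|exact: elementary_bump_sum].
Qed.

Lemma cutoff_le1 s x : cutoff s x <= 1.
Proof.
by rewrite /cutoff gerDl mulr_le0_ge0 ?gexp_ge0// lerNl oppr0 invr_ge0 gexp_ge0.
Qed.

Lemma cutoff_ge0 s x : 0 <= cutoff s x.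
Proof.
rewrite /cutoff [X in _ + X]mulNr subr_ge0 mulrC ler_pdivrMr ?gexp_gt0// mul1r.
by rewrite gexp0_homo// mulN1r gerBl bump_sum_ge0.
Qed.

Lemma cutoff_eq1 s z x : (forall z, z \in s -> 0 < z.2) ->
  z \in s -> eball z.1 z.2 x -> cutoff s x = 1.
Proof.
move=> s0 zs zx; rewrite /cutoff [gexp _ (1 + _)]gexp_le0 ?mulr0 ?addr0//.
rewrite mulN1r subr_le0; apply: (le_trans (bump_ge1 (s0 z zs) zx)).
rewrite /bump_sum (big_rem z)//= lerDl.
by apply: sumr_ge0 => *; exact: bump_ge0.
Qed.

Lemma bump_sum_eq0 s x : (forall z, z \in s -> 0 < z.2) ->
  ~ doubled s x -> bump_sum s x = 0.
Proof.
move=> s0 sx; rewrite /bump_sum big1_seq// => z /= zs; apply: bump_eq0.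
  exact: s0.
by move=> zx; apply: sx; exists z.
Qed.

Lemma cutoff_eq0 s x : (forall z, z \in s -> 0 < z.2) ->
  ~ doubled s x -> cutoff s x = 0.
Proof.
move=> s0 sx; rewrite /cutoff bump_sum_eq0// mulr0 addr0.
by rewrite mulNr mulVf ?subrr// gt_eqF// gexp_gt0.
Qed.

Lemma partial_bump i z x : partial i (bump z) x =
  gexp 2 (bump_arg z x) / gexp 0 (3 : R) * (2 * z.2 ^- 2 * (z.1 - x) 0 i).
Proof.
have da y := elementary_differentiable y (elementary_bump_arg z).
have dg y : differentiable (fun x => gexp 0 (bump_arg z x)) y.
  exact/elementary_differentiable/elementary_gexp/elementary_bump_arg.
rewrite /bump partialM//.
rewrite partial_cst mulr0 add0r partial_gexp// mul0r subr0 mulrA.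
rewrite [_ * gexp 2 _]mulrC; congr (_ * _).
have dc j y : differentiable (fun x => (z.1 - x) 0 j) y.
  rewrite (_ : (fun _ => _) = (fun x => z.1 0 j - x 0 j)).
    by apply: differentiableB;
      [exact: differentiable_cst|exact: differentiable_coord].
  by apply/funext => t; rewrite !mxE.
have pc j y : partial i (fun x => (z.1 - x) 0 j) y = - (j == i)%:R.
  rewrite (_ : (fun _ => _) = (fun x => z.1 0 j + -1 * x 0 j)).
    rewrite partialD; [|exact: differentiable_cst|]; last first.
      by apply: differentiableM;
        [exact: differentiable_cst|exact: differentiable_coord].
    rewrite partialM; [|exact: differentiable_cst|exact: differentiable_coord].
    by rewrite !partial_cst partial_coord mulr0 addr0 add0r mulN1r.
  by apply/funext => t; rewrite !mxE mulN1r.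
have dq y : differentiable (fun x => edot (z.1 - x) (z.1 - x)) y.
  rewrite /edot (_ : (fun _ => _) =
      \sum_j (fun x => (z.1 - x) 0 j * (z.1 - x) 0 j)).
    by apply: differentiable_sum => j; apply: differentiableM; exact: dc.
  by apply/funext => t; rewrite fct_sumE.
rewrite /bump_arg partialD; [|exact: differentiable_cst|]; last first.
  by apply: differentiableM => //; exact: differentiable_cst.
rewrite partialM//.
rewrite !partial_cst mulr0 add0r addr0 [X in _ * X]partial_sum; last first.
  by move=> j; apply: differentiableM; exact: dc.
rewrite (bigD1 i)//= big1 ?addr0; last first.
  move=> j ji; rewrite partialM; [|exact: dc|exact: dc].
  by rewrite !pc (negbTE ji) oppr0 mulr0 addr0.
rewrite partialM; [|exact: dc|exact: dc].
rewrite !pc eqxx (_ : 1 *- true = -1 :> R)//; move: ((z.1 - x) 0 i) => w; ring.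
Qed.

Lemma partial_cutoff i s x : partial i (cutoff s) x =
  gexp 2 (1 - bump_sum s x) / gexp 0 (1 : R) * \sum_(z <- s) partial i (bump z) x.
Proof.
have db y := elementary_differentiable y (elementary_bump_sum s).
have du y : differentiable (fun x => 1 + -1 * bump_sum s x) y.
  apply: differentiableD; first exact: differentiable_cst.
  by apply: differentiableM => //; exact: differentiable_cst.
have dg y : differentiable (fun x => gexp 0 (1 + -1 * bump_sum s x)) y.
  apply: elementary_differentiable; apply: elementary_gexp.
  apply: elementaryD; first exact: elementary_cst.
  by apply: elementaryM; [exact: elementary_cst|exact: elementary_bump_sum].
rewrite /cutoff partialD; [|exact: differentiable_cst|]; last first.
  by apply: differentiableM => //; exact: differentiable_cst.
rewrite partialM//.
rewrite !partial_cst mulr0 add0r addr0 partial_gexp// mul0r subr0.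
rewrite partialD; [|exact: differentiable_cst|]; last first.
  by apply: differentiableM => //; exact: differentiable_cst.
rewrite partialM//.
rewrite !partial_cst mulr0 add0r addr0 mulN1r mulN1r.
have -> : partial i [eta bump_sum s] x = \sum_(z <- s) partial i (bump z) x.
  apply: partial_sum => z; exact/elementary_differentiable/elementary_bump.
by ring.
Qed.

End cutoff.

Local Ltac nonneg := repeat first [ done | exact: powR_ge0 | exact: gexp_ge0
  | exact: sqr_ge0 | exact: enorm_ge0 | exact: bump_sum_ge0 | exact: ltW
  | rewrite invr_ge0 | apply: mulr_ge0 | apply: exprn_ge0 ].

(** * Pointwise bound on the gradient of the cutoff *)

Section gradient_bound.
Variables (R : realType) (N : nat) (p q : R).
Hypotheses (p0 : 0 < p) (q0 : 0 < q) (pq : p^-1 + q^-1 = 1).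
Implicit Types (x y a : 'rV[R]_N) (z : 'rV[R]_N * R) (s : seq ('rV[R]_N * R)).

(** Young's inequality for t a and b / t, with the weights 1/p and 1/q bounded by 1. The free scale
    t later balances a term that tends to 0 against one that is merely bounded. *)
Lemma young_scaled (a b t : R) : 0 <= a -> 0 <= b -> 0 < t ->
  a * b <= t `^ p * a `^ p + t `^ (- q) * b `^ q.
Proof.
move=> a0 b0 t0.
have -> : a * b = (t * a) * (t^-1 * b).
  by rewrite mulrACA mulfV ?mul1r// gt_eqF.
have ti : 0 <= t^-1 by rewrite invr_ge0 ltW.
apply: (le_trans (conjugate_powR (mulr_ge0 (ltW t0) a0) (mulr_ge0 ti b0) p0 q0 pq)).
rewrite !powRM ?(ltW t0)//.
have -> : t^-1 `^ q = t `^ (- q).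
  by rewrite powRN -powR_inv1 ?(ltW t0)// -powRrM mulN1r powRN.
have p1 : p^-1 <= 1 by rewrite -pq lerDl invr_ge0 ltW.
have q1 : q^-1 <= 1 by rewrite -pq lerDr invr_ge0 ltW.
by rewrite lerD// ler_piMr// mulr_ge0 ?powR_ge0.
Qed.

Lemma gexp0_le1 (u : R) : gexp 0 u <= 1.
Proof.
have [u0|/gexp_le0 ->//] := ltP 0 u.
by apply: (le_trans (gexp_ub 0 0 u0)); rewrite !expr0 mulr1.
Qed.

(** On the doubled ball |z.1 - x| < 2 r, so the inner derivative 2 |z.1 - x| / r^2 is at most 4 / r;
    together with the factor 4 q^2 of [gexp2_le] this gives 16 q^2. *)
Lemma ler_norm_partial_bump i z x : 0 < z.2 ->
  `|partial i (bump z) x| <= 16 * q ^+ 2 / gexp 0 (3 : R) *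
    (gexp 0 (bump_arg z x) `^ p^-1 * (z.2^-1 * \1_(eball z.1 (2 * z.2)) x)).
Proof.
move=> z0; rewrite partial_bump.
have c0 : 0 < (gexp 0 (3 : R))^-1 by rewrite invr_gt0 gexp_gt0.
have [zx|/negP zx] := boolP (enorm (z.1 - x) < 2 * z.2); last first.
  have u0 : bump_arg z x <= 0 by rewrite leNgt bump_arg_gt0//; exact/negP.
  by rewrite gexp_le0// !mul0r normr0; nonneg.
rewrite indicE mem_set// mulr1 normrM ger0_norm; last by nonneg.
have h1 := gexp2_le (bump_arg z x) q0 pq.
have h2 : `|2 / z.2 ^+ 2 * (z.1 - x) 0 i| <= 4 / z.2.
  rewrite normrM ger0_norm; last by nonneg.
  have -> : 4 / z.2 = 2 / z.2 ^+ 2 * (2 * z.2) by field; rewrite gt_eqF.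
  rewrite ler_wpM2l//; first by nonneg.
  by rewrite (le_trans (ler_coord_enorm _ _))// ltW.
apply: (@le_trans _ _ (4 * q ^+ 2 * gexp 0 (bump_arg z x) `^ p^-1 /
  gexp 0 3 * (4 / z.2))).
  apply: ler_pM => //; first by nonneg.
  by rewrite ler_wpM2r// ltW.
by rewrite le_eqVlt; apply/orP; left; apply/eqP; ring.
Qed.

Lemma bump_sum_arg s x : \sum_(z <- s) gexp 0 (bump_arg z x) =
  gexp 0 3 * bump_sum s x.
Proof.
by rewrite /bump_sum /bump -mulr_suml mulrCA mulfV ?mulr1// gt_eqF// gexp_gt0.
Qed.

(** The factor N comes from passing from coordinates to the scalar product, [4 / gexp 0 1] bounds
    the outer derivative of the cutoff, and the last factor is the constant of a single bump. *)
Definition gradient_const : R :=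
  N%:R * (4 / gexp 0 (1 : R) * (16 * q ^+ 2 / gexp 0 (3 : R))).

Lemma gradient_const_ge0 : 0 <= gradient_const.
Proof. by rewrite /gradient_const; nonneg. Qed.

(* Since |grad bump| is at most a constant times bump^(1/p) / r, Young's
   inequality applied bump by bump costs only the sum of the bumps, which is at
   most 1 wherever the cutoff is not locally constant. *)
Lemma ler_norm_edot_gradient_cutoff s x a (t : R) :
  (forall z, z \in s -> 0 < z.2) -> 0 < t ->
  `|edot a (gradient (cutoff s) x)| <= gradient_const *
    (t `^ p * (enorm a `^ p * \1_(doubled s) x) +
     t `^ (- q) * \sum_(z <- s) z.2 `^ (- q) * \1_(eball z.1 (2 * z.2)) x).
Proof.
move=> s0 t0.
have rhs0 : 0 <= t `^ p * (enorm a `^ p * \1_(doubled s) x) +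
     t `^ (- q) * \sum_(z <- s) z.2 `^ (- q) * \1_(eball z.1 (2 * z.2)) x.
  rewrite addr_ge0//; first by nonneg.
  by apply: mulr_ge0; [nonneg|apply: sumr_ge0 => z _; nonneg].
have [S1|S1] := leP 1 (bump_sum s x).
  have -> : gradient (cutoff s) x = 0.
    apply/rowP => i; rewrite !mxE partial_cutoff gexp_le0 ?mul0r//.
    by rewrite subr_le0.
  rewrite /edot big1 ?normr0; first by apply: mulr_ge0 => //;
    exact: gradient_const_ge0.
  move=> i _.
  by rewrite mxE mulr0.
pose G z := gexp 0 (bump_arg z x).
pose X z : R := \1_(eball z.1 (2 * z.2)) x.
pose K : R := 4 / gexp 0 (1 : R) * (16 * q ^+ 2 / gexp 0 (3 : R)).
have K0 : 0 <= K by rewrite /K; nonneg.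
have gi i : `|gradient (cutoff s) x 0 i| <=
    K * \sum_(z <- s) G z `^ p^-1 * (z.2^-1 * X z).
  rewrite mxE partial_cutoff normrM ger0_norm; last by nonneg.
  rewrite /K -[leRHS]mulrA; apply: ler_pM => //; first by nonneg.
    apply: ler_wpM2r; first by nonneg.
    have u0 : 0 < 1 - bump_sum s x by rewrite subr_gt0.
    by apply: (le_trans (gexp_ub 2 0 u0)); rewrite expr0 expr2 mulr1 -natrM.
  apply: (le_trans (ler_norm_sum _ _ _)).
  rewrite mulr_sumr big_seq [leRHS]big_seq; apply: ler_sum => z zs.
  exact/ler_norm_partial_bump/s0.
apply: (le_trans (ler_norm_edot _ gi)).
rewrite /gradient_const -/K -[leLHS]mulrA -[leRHS]mulrA.
rewrite ler_wpM2l// mulrCA ler_wpM2l//.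
(* Young is applied to |a| G^(1/p) and X / r; the power p turns G^(1/p) back into G, whose sum over
   the balls is at most 1. *)
apply: (@le_trans _ _ (\sum_(z <- s)
    (t `^ p * (enorm a `^ p * \1_(doubled s) x) * G z +
     t `^ (- q) * (z.2 `^ (- q) * X z)))).
  rewrite mulr_sumr big_seq [leRHS]big_seq; apply: ler_sum => z zs.
  have z0 := s0 _ zs; have G0 : 0 <= G z by exact: gexp_ge0.
  rewrite /X indicE; case: (boolP (x \in eball _ _)) => [/set_mem zx|_]; last first.
    by rewrite !mulr0 addr0; nonneg.
  rewrite indicE mem_set; last by exists z.
  rewrite !mulr1 mulrA.
  apply: (le_trans (young_scaled _ _ t0)); try by nonneg.
  rewrite powRM ?enorm_ge0 ?powR_ge0// -powRrM mulVf ?gt_eqF// powRr1//.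
  rewrite mulrA lerD2l -powR_inv1 ?(ltW z0)// -powRrM mulN1r.
  exact: lexx.
rewrite big_split/= -mulr_sumr bump_sum_arg -mulr_sumr lerD2r.
rewrite ler_piMr//; first by nonneg.
by rewrite mulr_ile1 ?gexp_ge0 ?bump_sum_ge0 ?gexp0_le1// ltW.
Qed.

End gradient_bound.

(** * Coverings by Euclidean balls *)

Section lebesgue_balls.
Variable R : realType.

Lemma measurable_ball_rV n (x : 'rV[R]_n) (r : R) : 0 < r ->
  measurable (ball x r).
Proof. by move=> r0; apply: open_measurable_rV; exact: ball_open. Qed.

(** For the sup norm a ball is a cube of side 2 r, and its preimage under [consrV] is an interval
    times a lower-dimensional cube. In dimension 0 it is the single point, of Dirac mass 1. *)
Lemma leb_ball n (x : 'rV[R]_n) (r : R) : 0 < r ->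
  leb n (ball x r) = ((2 * r) ^+ n)%:E.
Proof.
move=> r0; elim: n x => [|n IH] x.
  rewrite expr0 /= /dirac indicE mem_set//.
  by split=> // i [].
pose tl : 'rV[R]_n := \row_i x 0 (lift ord0 i).
rewrite -[LHS]/((lebesgue_measure \x leb n)%E (@consrV R n @^-1` ball x r)).
have -> : @consrV R n @^-1` ball x r = ball (x 0 0) r `*` ball tl r.
  apply/seteqP; split=> [[a b] [_ h]|[a b] [/= ha [_ hb]]].
    split; first by have := h 0 ord0; rewrite consrVE unlift_none.
    split=> // i j; rewrite (ord1 i) !mxE; have := h 0 (lift ord0 j).
    by rewrite consrVE liftK.
  split=> // i j; rewrite (ord1 i) consrVE; case: unliftP => [k ->|->//].
  by have := hb 0 k; rewrite mxE.
rewrite product_measure1E; [|exact: measurable_ball|exact: measurable_ball_rV].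
rewrite IH [X in (X * _)%E](_ : _ = (r *+ 2)%:E); last first.
  exact: (lebesgue_measure_ball (x 0 0) (ltW r0)).
rewrite -EFinM exprS.
by congr (_ * _)%:E; rewrite mulr_natl.
Qed.

Variable N : nat.
Implicit Types (x y : 'rV[R]_N) (r : R).

Lemma open_eball x r : open (eball x r).
Proof.
have [r0|r0] := leP r 0.
  rewrite (_ : eball x r = set0); first exact: open0.
  rewrite -subset0 => y; rewrite /eball/= ltNge => /negP; apply.
  by rewrite (le_trans r0)// enorm_ge0.
(* The ball of radius r is the doubled ball of radius r / 2, hence a positivity set of a continuous
   function. *)
have -> : eball x r = bump_arg (x, r / 2) @^-1` [set u | 0 < u].
  apply/seteqP; split=> y; rewrite /eball/= bump_arg_gt0/= ?divr_gt0//;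
    by rewrite [2 * _]mulrC divfK.
apply: open_comp; last exact: open_gt.
move=> y _; apply: differentiable_continuous.
exact/elementary_differentiable/elementary_bump_arg.
Qed.

Lemma measurable_eball x r : measurable (eball x r).
Proof. by apply: open_measurable_rV; exact: open_eball. Qed.

Lemma leb_eball_le x r : 0 < r -> (leb N (eball x r) <= ((2 * r) ^+ N)%:E)%E.
Proof.
move=> r0; rewrite -(leb_ball x r0); apply: le_measure; rewrite ?inE.
- exact: measurable_eball.
- exact: measurable_ball_rV.
- exact: eball_sub_ball.
Qed.

Lemma leb_eball_fin_num x r : 0 < r -> leb N (eball x r) \is a fin_num.
Proof.
by move=> r0; rewrite ge0_fin_numE// (le_lt_trans (leb_eball_le x r0))// ltry.
Qed.

(** The inequality behind it is N < (N + 1)^2; dividing by N + 1 rather than by the square root of N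
    also covers N = 0. *)
Lemma ball_sub_eball x r : 0 < r -> ball x (r / N.+1%:R) `<=` eball x r.
Proof.
move=> r0 y [_ xy]; rewrite /eball/= enorm_sub_ltE//.
apply: (@le_lt_trans _ _ (\sum_(i < N) (r / N.+1%:R) ^+ 2)).
  apply: ler_sum => i _; rewrite -expr2 !mxE -(real_normK (num_real _)).
  by rewrite lerXn2r ?nnegrE ?divr_ge0 ?(ltW r0)// ltW//; exact: xy.
rewrite sumr_const card_ord exprMn -[X in X < _]mulr_natr -[X in X < _]mulrA.
rewrite gtr_pMr ?exprn_gt0// exprVn mulrC ltr_pdivrMr ?exprn_gt0// mul1r.
by rewrite -natrX ltr_nat expnS expn1 leq_pmulr.
Qed.

Lemma leb_eball_gt0 x r : 0 < r -> (0 < leb N (eball x r))%E.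
Proof.
move=> r0; apply: (@lt_le_trans _ _ (leb N (ball x (r / N.+1%:R)))).
  by rewrite leb_ball ?divr_gt0// lte_fin exprn_gt0// mulr_gt0 ?divr_gt0.
apply: le_measure; rewrite ?inE; last exact: ball_sub_eball.
  by apply: measurable_ball_rV; rewrite divr_gt0.
exact: measurable_eball.
Qed.

End lebesgue_balls.

Lemma ler_sum_uniq_nat (R : numDomainType) (f : nat -> R) (s : seq nat) (n : nat) :
  uniq s -> {in s, forall i, (i < n)%N} -> (forall i, 0 <= f i) ->
  \sum_(i <- s) f i <= \sum_(0 <= i < n) f i.
Proof.
move=> us sn f0.
have -> : \sum_(i <- s) f i = \sum_(0 <= i < n | i \in s) f i.
  rewrite -[RHS]big_filter; apply: perm_big; apply: uniq_perm => //.
    by rewrite filter_uniq// iota_uniq.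
  move=> i; rewrite mem_filter mem_index_iota /=.
  by case: (boolP (i \in s)) => // /sn ->.
by rewrite big_mkcond/=; apply: ler_sum => i _; case: ifP.
Qed.

Lemma sum_half_le (R : realFieldType) (n : nat) :
  \sum_(0 <= i < n) (2^-1 : R) ^+ i <= 2.
Proof.
suff -> : \sum_(0 <= i < n) (2^-1 : R) ^+ i = 2 - 2 * 2^-1 ^+ n.
  by rewrite gerBl mulr_ge0// exprn_ge0// invr_ge0.
elim: n => [|n IH]; first by rewrite big_geq// expr0; ring.
by rewrite big_nat_recr//= IH exprS; field.
Qed.

Section hausdorff_cover.
Variables (R : realType) (N : nat).
Implicit Types (K C : set 'rV[R]_N) (r : R) (s : seq ('rV[R]_N * R)).

(** Centres are taken in K so that the doubled balls stay within distance 2 r of K. *)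
Definition ball_cover (r : R) K s := (forall z, z \in s -> K z.1 /\ 0 < z.2 <= r) /\
  K `<=` \bigcup_(z in [set z | z \in s]) eball z.1 z.2.

Lemma compact_ball_cover r K : compact K -> 0 < r -> exists s, ball_cover r K s.
Proof.
rewrite compact_cover => cK r0.
have [|x Kx|D DK KD] := cK _ K (fun x => eball x r).
- by move=> x _; exact: open_eball.
- by exists x => //; exact: eball_center.
exists [seq (x, r) | x <- finmap.enum_fset D]; split.
  move=> _ /mapP[x xD ->] /=.
  by split; [exact/set_mem/DK|rewrite r0 lexx].
by move=> x /KD[y /= yD xy]; exists (y, r) => //=; apply/mapP; exists y.
Qed.

Lemma enorm_diam C x y : C x -> C y -> ((enorm (x - y))%:E <= diam C)%E.
Proof. by move=> Cx Cy; apply: ereal_sup_ubound; exists (x, y). Qed.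

Lemma diam_ge0 C : C !=set0 -> (0 <= diam C)%E.
Proof. by move=> [x Cx]; have := enorm_diam Cx Cx; rewrite subrr enorm0. Qed.

Lemma diam_pow_ge0 (alpha : R) C : (0 <= diam_pow alpha C)%E.
Proof. by rewrite /diam_pow; case: ifP => // _; exact: poweR_ge0. Qed.

(** A covering set that meets K lies in a ball centred at a common point, with radius about twice
    its diameter; compactness leaves finitely many. Starting from sets of diameter at most r / 2
    keeps the radii at most r. *)
Lemma hausdorff_ball_cover (alpha : R) K : compact K -> 0 <= alpha ->
  (hausdorff_measure alpha K < +oo)%E ->
  exists M : R, forall r, 0 < r ->
    exists2 s, ball_cover r K s & \sum_(z <- s) z.2 `^ alpha <= M.
Proof.
move=> cK alpha0; set H := hausdorff_measure alpha K => Hoo.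
(* The factor 2^alpha pays for doubling the diameters, the 1 for the infimum not being attained, the
   last 2 for the sum of the powers of 1/2. *)
exists (2 `^ alpha * (fine H + 1) + 2) => r r0.
have : (hausdorff_premeasure alpha (r / 2) K < (fine H + 1)%:E)%E.
  apply: (@le_lt_trans _ _ H).
    by apply: ereal_sup_ubound; exists (r / 2) => //=; rewrite divr_gt0.
  by case: H Hoo => [h|//|] _; rewrite ?ltNyr// lte_fin ltrDl.
move=> /ereal_inf_lt[_ [C [KC dC] <-] HC].
have dC0 i : C i !=set0 -> diam (C i) \is a fin_num.
  by move=> Ci; rewrite ge0_fin_numE ?diam_ge0// (le_lt_trans (dC i))// ltry.
pose d i := fine (diam (C i)).
(* A set of diameter 0 still needs a ball of positive radius. For alpha > 0 the radius [eps i] costs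
   at most 2^(-i) once raised to alpha. *)
pose eps i : R := Num.min r ((2^-1 ^+ i) `^ alpha^-1).
pose rad i := Num.max (2 * d i) (eps i).
pose b i := fine (diam_pow alpha (C i)).
have bE i : (b i)%:E = diam_pow alpha (C i).
  rewrite /b fineK// /diam_pow; case: ifPn => // /set0P Ci.
  by rewrite fin_num_poweR// dC0.
have b0 i : 0 <= b i by rewrite -lee_fin bE diam_pow_ge0.
have eps0 i : 0 < eps i.
  by rewrite lt_min r0 powR_gt0// exprn_gt0// invr_gt0.
have rad0 i : 0 < rad i by rewrite lt_max eps0 orbT.
have d0 i : C i !=set0 -> 0 <= d i by move=> Ci; rewrite fine_ge0// diam_ge0.
have radr i : C i !=set0 -> rad i <= r.
  move=> Ci; rewrite ge_max ge_min lexx andbT mulrC -ler_pdivlMr//.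
  by rewrite -lee_fin fineK ?dC0.
have rada i : C i !=set0 -> rad i `^ alpha <= 2 `^ alpha * b i + 2^-1 ^+ i.
  move=> Ci.
  have -> : b i = d i `^ alpha.
    apply: EFin_inj; rewrite bE /diam_pow ifF; last exact/negbTE/set0P.
    by rewrite -poweR_EFin fineK// dC0.
  rewrite -powRM ?d0// /rad; case: (leP (2 * d i) (eps i)) => _; last first.
    by rewrite lerDl exprn_ge0// invr_ge0.
  (* For alpha = 0 the power of [eps i] is 1 and not small; it is absorbed by the power of the
     diameter, which is also 1 because 0^0 = 1. *)
  move: alpha0; rewrite le_eqVlt => /predU1P[<-|alpha0].
    by rewrite !powRr0 lerDl exprn_ge0// invr_ge0.
  apply: (@le_trans _ _ (2^-1 ^+ i)); last by rewrite lerDr powR_ge0.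
  apply: (@le_trans _ _ (((2^-1 ^+ i) `^ alpha^-1) `^ alpha)).
    rewrite ge0_ler_powR ?nnegrE ?(ltW alpha0) ?(ltW (eps0 i)) ?powR_ge0//.
    by rewrite ge_min lexx orbT.
  by rewrite -powRrM mulVf ?gt_eqF// powRr1// exprn_ge0// invr_ge0.
pose x i := xget 0 (C i `&` K).
pose D := [set i | C i `&` K !=set0].
have xP i : D i -> C i (x i) /\ K (x i) by move=> Di; exact: (xgetPex 0 Di).
have DC i : D i -> C i !=set0 by move=> [y [Cy _]]; exists y.
move: cK; rewrite compact_cover => /(_ _ D (fun i => eball (x i) (rad i))).
case => [i _|y Ky|E ED KE].
- exact: open_eball.
- have [i _ Ciy] := KC _ Ky; have Di : D i by exists y.
  exists i => //; rewrite /eball/=.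
  have [Cx _] := xP _ Di.
  have := enorm_diam Cx Ciy; rewrite -[diam (C i)]fineK ?dC0//; last exact: DC.
  rewrite lee_fin -/(d i) => xd; apply: (le_lt_trans xd).
  rewrite lt_max; case: (ltP 0 (d i)) => [d1|d1]; first by rewrite ltr_pMl ?ltr1n.
  by rewrite (le_lt_trans d1 (eps0 i)) orbT.
exists [seq (x i, rad i) | i <- finmap.enum_fset E].
  split=> [_ /mapP[i iE ->]/=|y /KE[i /= iE xy]].
    have Di : D i by exact/set_mem/ED.
    by split; [have [] := xP _ Di|rewrite rad0 radr//; exact: DC].
  by exists (x i, rad i) => //=; apply/mapP; exists i.
rewrite big_map/=.
apply: (@le_trans _ _ (\sum_(i <- finmap.enum_fset E)
  (2 `^ alpha * b i + 2^-1 ^+ i))).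
  rewrite big_seq [leRHS]big_seq; apply: ler_sum => i iE.
  by apply: rada; apply: DC; exact/set_mem/ED.
pose n := (\max_(i <- finmap.enum_fset E) i).+1.
apply: (@le_trans _ _ (\sum_(0 <= i < n) (2 `^ alpha * b i + 2^-1 ^+ i))).
  apply: ler_sum_uniq_nat => [|i iE|i]; first exact: finmap.fset_uniq.
    by rewrite /n ltnS (big_rem i)//= leq_maxl.
  by rewrite addr_ge0 ?mulr_ge0 ?powR_ge0// exprn_ge0// invr_ge0.
rewrite big_split/= -mulr_sumr lerD ?sum_half_le// ler_wpM2l ?powR_ge0//.
rewrite -lee_fin (le_trans _ (ltW HC))// -sumEFin.
under eq_bigr do rewrite bE.
by apply: nneseries_lim_ge => *; exact: diam_pow_ge0.
Qed.

End hausdorff_cover.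

(** * Inner regularity and signed Radon measures *)

Section regularity.
Variables (R : realType) (N : nat).
Notation T := 'rV[R]_N.
Implicit Types (A F U : set T) (n : nat).

Lemma closed_measurable_rV F : closed F -> measurable F.
Proof.
move=> cF; rewrite -(setCK F); apply: measurableC.
by apply: open_measurable_rV; rewrite openC.
Qed.

Lemma compact_closed_rV F : compact F -> closed F.
Proof. by apply: compact_closed; exact: norm_hausdorff. Qed.

Lemma compact_measurable_rV F : compact F -> measurable F.
Proof. by move=> /compact_closed_rV; exact: closed_measurable_rV. Qed.

(** The points at sup-distance at least 1/(n+1) from the complement of U: a closed exhaustion when U
    is open. *)
Definition inner_core U n : set T := ~` \bigcup_(y in ~` U) ball y n.+1%:R^-1.

Lemma closed_inner_core U n : closed (inner_core U n).
Proof.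
by rewrite closedC; apply: bigcup_open => y _; exact: ball_open.
Qed.

Lemma inner_core_homo U : {homo inner_core U : n m / (n <= m)%N >-> n `<=` m}.
Proof.
move=> n m nm; apply: subsetC => x [y Uy yx]; exists y => //.
by apply: le_ball yx; rewrite lef_pV2 ?posrE// ler_nat.
Qed.

Lemma inner_core_sub U n : inner_core U n `<=` U.
Proof.
move=> x; apply: contra_notP => Ux; exists x => //.
exact: ballxx.
Qed.

Lemma bigcup_inner_core U : open U -> \bigcup_n inner_core U n = U.
Proof.
move=> oU; apply/seteqP; split=> [x [n _]|x Ux]; first exact: inner_core_sub.
have /nbhs_ballP[e /= e0 eU] : nbhs x U by exact: open_nbhs_nbhs.
have [k] := ltr_add_invr e0; rewrite add0r => ke.
exists k => // -[y Uy yx]; apply: Uy; apply: eU; apply: (le_ball (ltW ke)).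
exact: ball_sym.
Qed.

Variable m : {finite_measure set T -> \bar R}.

Lemma fin_measure_decreasing_lt (F : (set T)^nat) (e : \bar R) :
  (forall n, measurable (F n)) -> {homo F : n m / (n <= m)%N >-> m `<=` n} ->
  (m (\bigcap_n F n) < e)%E -> exists n, (m (F n) < e)%E.
Proof.
move=> mF dF me.
have : m \o F @ \oo --> m (\bigcap_n F n).
  apply: nonincreasing_cvg_mu => //.
  - by rewrite -ge0_fin_numE// fin_num_measure.
  - exact: bigcap_measurable.
  - by move=> i j ij; apply/subsetPset; exact: dF.
move=> /(_ [set x | (x < e)%E])[|n _ h].
  by apply: open_nbhs_nbhs; split => //; exact: open_ereal_lt_ereal.
by exists n; apply: h => /=.
Qed.

(** Approximating from both sides makes the property stable under complement, so that the sets
    having it form a sigma-algebra that contains the open sets. *)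
Definition regular_set A := forall e : R, 0 < e -> exists FU : set T * set T,
  [/\ closed FU.1, open FU.2, FU.1 `<=` A, A `<=` FU.2 &
      (m (FU.2 `\` FU.1) < e%:E)%E].

Lemma open_regular U : open U -> regular_set U.
Proof.
move=> oU e e0.
have [|||n mn] := @fin_measure_decreasing_lt (fun n => U `\` inner_core U n) e%:E.
- move=> n; apply: measurableD; first exact: open_measurable_rV.
  by apply: closed_measurable_rV; exact: closed_inner_core.
- by move=> i j ij; apply: setDS; exact: inner_core_homo.
- rewrite bigcupDr; last by exists 0%N.
  by rewrite bigcup_inner_core// setDv measure0 lte_fin.
exists (inner_core U n, U); split=> //.
  exact: closed_inner_core.
exact: inner_core_sub.
Qed.

Lemma regular_setC A : regular_set A -> regular_set (~` A).
Proof.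
move=> rA e e0; have [[F U] [/= cF oU FA AU FUe]] := rA e e0.
exists (~` U, ~` F); split=> /=; [by rewrite closedC|by rewrite openC| | |].
- exact: subsetC.
- exact: subsetC.
- by rewrite setDE setCK setIC -setDE.
Qed.

Lemma regular_bigcup (A : (set T)^nat) :
  (forall k, regular_set (A k)) -> regular_set (\bigcup_k A k).
Proof.
move=> rA e e0.
have e2 : 0 < e / 2 by rewrite divr_gt0.
have /choice[FU FUP] : forall k, exists FU : set T * set T,
    [/\ closed FU.1, open FU.2, FU.1 `<=` A k, A k `<=` FU.2 &
      (m (FU.2 `\` FU.1) < (e / 2 / (2 ^ k.+1)%:R)%:E)%E].
  by move=> k; apply: rA; rewrite divr_gt0// ltr0n expn_gt0.
pose U := \bigcup_k (FU k).2.
have oU : open U by apply: bigcup_open => k _; have [] := FUP k.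
have mF k : measurable (FU k).1 by apply: closed_measurable_rV; have [] := FUP k.
have mU k : measurable (FU k).2 by apply: open_measurable_rV; have [] := FUP k.
have mFU : (m (U `\` \bigcup_k (FU k).1) <= (e / 2)%:E)%E.
  apply: (le_trans _ (epsilon_trick0 xpredT (ltW e2))).
  apply: (@le_trans _ _ (\sum_(0 <= k <oo) m ((FU k).2 `\` (FU k).1))%E).
    apply: measure_sigma_subadditive.
    - by move=> k; exact: measurableD.
    - apply: measurableD; first exact: open_measurable_rV.
      exact: bigcupT_measurable.
    - move=> x [[k _ Ux] nF]; exists k => //; split=> // Fx.
      by apply: nF; exists k.
  by apply: lee_nneseries => // k _; have [_ _ _ _ /ltW] := FUP k.
(* A countable union of closed sets need not be closed; finite unions are, and continuity from above
   makes one of them good enough. The allowance e / 2 so far leaves a strict margin below e. *)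
pose F n := \bigcup_(k in `I_n) (FU k).1.
have cF n : closed (F n).
  by apply: closed_bigcup; [exact: finite_II|move=> k _; have [] := FUP k].
have [|||n mn] := @fin_measure_decreasing_lt (fun n => U `\` F n) e%:E.
- move=> n; apply: measurableD; first exact: open_measurable_rV.
  exact: closed_measurable_rV.
- move=> i j ij; apply: setDS => x [k /= ki Fx]; exists k => //=.
  exact: leq_trans ij.
- rewrite bigcupDr; last by exists 0%N.
  apply: (@le_lt_trans _ _ (e / 2)%:E); last first.
    by rewrite lte_fin ltr_pdivrMr// ltr_pMr// ltr1n.
  apply: le_trans mFU; apply: le_measure; rewrite ?inE.
  + apply: measurableD; first exact: open_measurable_rV.
    by apply: bigcupT_measurable => n; exact: closed_measurable_rV.
  + apply: measurableD; first exact: open_measurable_rV.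
    exact: bigcupT_measurable.
  + by apply: setDS => x [k _ Fx]; exists k.+1 => //; exists k => /=.
exists (F n, U); split=> //=.
- by move=> x [k _ Fx]; exists k => //; have [_ _ FA _ _] := FUP k; exact: FA.
- by move=> x [k _ Ax]; exists k => //; have [_ _ _ AU _] := FUP k; exact: AU.
Qed.

Lemma measurable_regular A : measurable A -> regular_set A.
Proof.
apply: smallest_sub; last by move=> U; exact: open_regular.
split=> [|B rB|B rB].
- exact/open_regular/open0.
- by rewrite setTD; exact: regular_setC.
- exact: regular_bigcup.
Qed.

Lemma measure_inner_closed A (e : R) : measurable A -> 0 < e ->
  exists F, [/\ closed F, F `<=` A & (m (A `\` F) < e%:E)%E].
Proof.
move=> mA e0; have [[F U] [/= cF oU FA AU FUe]] := measurable_regular mA e0.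
exists F; split=> //; apply: le_lt_trans FUe; apply: le_measure; rewrite ?inE.
- by apply: measurableD => //; exact: closed_measurable_rV.
- by apply: measurableD; [exact: open_measurable_rV|exact: closed_measurable_rV].
- exact: setSD.
Qed.

End regularity.

Section charge_jordan.
Context d (T : measurableType d) (R : realType).
Variables (nu : {charge set T -> \bar R}) (P N : set T).
Variable nuPN : hahn_decomposition nu P N.
Local Open Scope ereal_scope.

Lemma charge_jordanE A : measurable A ->
  nu A = jordan_pos nuPN A - jordan_neg nuPN A.
Proof. by move=> mA; rewrite (jordan_decomp nuPN mA) /cadd/= cscaleN1. Qed.

Lemma jordan_pos_setI A : measurable A -> jordan_pos nuPN A = nu (A `&` P).
Proof. by move=> mA; rewrite jordan_posE cjordan_posE /crestr0 mem_set. Qed.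

Lemma jordan_neg_setI A : measurable A -> jordan_neg nuPN A = - nu (A `&` N).
Proof. by move=> mA; rewrite jordan_negE cjordan_negE /crestr0 mem_set. Qed.

End charge_jordan.

Section pos_variation.
Variables (R : realType) (N : nat) (Omega : set 'rV[R]_N).
Implicit Types (mu : sradon Omega) (C K : set 'rV[R]_N).
Local Open Scope ereal_scope.

(** On C the measure is a charge [nu] with a Hahn decomposition, and the supremum defining
    [pos_variation] is attained at the intersection of C with the positive set; likewise for the
    opposite measure. *)
Lemma sradon_jordan mu C : measurable C -> relatively_compact Omega C ->
  [/\ pos_variation mu C < +oo, pos_variation (sradon_opp mu) C < +oo &
      mu C = pos_variation mu C - pos_variation (sradon_opp mu) C].
Proof.
move=> mC rC; have [nu nuE] := sradon_relcompact mu rC.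
have [P [M nuPM]] := Hahn_decomposition nu.
have [[mP _] [mM _] _ _] := nuPM.
have pE : pos_variation mu C = jordan_pos nuPM C.
  apply/eqP; rewrite eq_le; apply/andP; split.
    apply: ge_ereal_sup => _ [D [mD rD DC] <-].
    rewrite nuE// (charge_jordanE nuPM mD).
    rewrite (@le_trans _ _ (jordan_pos nuPM D))//.
      by rewrite leeBlDr ?fin_num_measure// leeDl.
    by apply: le_measure; rewrite ?inE.
  rewrite jordan_pos_setI// -nuE; [|exact: measurableI|exact: subIsetl].
  apply: pos_variation_ub; [exact: measurableI| |exact: subIsetl].
  exact: relatively_compactS rC.
have nE : pos_variation (sradon_opp mu) C = jordan_neg nuPM C.
  apply/eqP; rewrite eq_le; apply/andP; split.
    apply: ge_ereal_sup => _ [D [mD rD DC] <-].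
    rewrite /= nuE// (charge_jordanE nuPM mD).
    rewrite (@le_trans _ _ (jordan_neg nuPM D))//.
      by rewrite fin_num_oppeB ?fin_num_measure// addeC leeBlDr
        ?fin_num_measure// leeDl.
    by apply: le_measure; rewrite ?inE.
  rewrite jordan_neg_setI// -nuE; [|exact: measurableI|exact: subIsetl].
  apply: (@pos_variation_ub _ _ _ (sradon_opp mu));
    [exact: measurableI| |exact: subIsetl].
  exact: relatively_compactS rC.
rewrite pE nE -charge_jordanE// -nuE//.
by split=> //; rewrite -ge0_fin_numE// fin_num_measure.
Qed.

Lemma relatively_compact_compact K : compact K -> K `<=` Omega ->
  relatively_compact Omega K.
Proof.
move=> cK KO; have clK : closed K.
  exact: compact_closed_rV.
by rewrite /relatively_compact -(closure_id K).1.
Qed.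

(** The value of a competitor D is at most the positive part of D [&] P, which is nearly exhausted
    by a closed F inside it. Such an F is compact because D is relatively compact, and on subsets of
    P the positive part is [mu] itself, so F has mass 0. *)
Lemma pos_variation_eq0 mu C :
  (forall K, compact K -> K `<=` C -> K `<=` Omega -> mu K = 0) ->
  pos_variation mu C = 0.
Proof.
move=> muK; apply/eqP; rewrite eq_le pos_variation_ge0 andbT.
apply: ge_ereal_sup => _ [D [mD rD DC] <-].
have [nu nuE] := sradon_relcompact mu rD.
have [P [M nuPM]] := Hahn_decomposition nu.
have [[mP _] [mM _] _ _] := nuPM.
have mDP : measurable (D `&` P) by exact: measurableI.
rewrite nuE// (charge_jordanE nuPM mD).
rewrite (@le_trans _ _ (jordan_pos nuPM (D `&` P)))//.
  rewrite leeBlDr ?fin_num_measure//.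
  by rewrite !jordan_pos_setI// -setIA setIid leeDl// -jordan_neg_setI.
apply/lee_addgt0Pr => e e0; rewrite add0e.
have [F [cF FD Fe]] := measure_inner_closed (jordan_pos nuPM) mDP e0.
have mF : measurable F by exact: closed_measurable_rV.
have FD' : F `<=` D by move=> x /FD[].
have F0 : jordan_pos nuPM F = 0.
  rewrite jordan_pos_setI// (_ : F `&` P = F); last by apply/setIidl => x /FD[].
  rewrite -nuE//; apply: muK.
  - apply: subclosed_compact cF (proj1 rD) _.
    exact: subset_trans FD' (@subset_closure _ _).
  - exact: subset_trans DC.
  - exact: subset_trans (subset_trans FD' (@subset_closure _ _)) (proj2 rD).
rewrite -(setDUK FD) measureU//; [|exact: measurableD|by rewrite setIC setDKI].
by rewrite [X in X + _]F0 add0e ltW.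
Qed.

Lemma pos_variation_opp_eq0 mu C :
  (forall K, compact K -> K `<=` C -> K `<=` Omega -> mu K = 0) ->
  pos_variation (sradon_opp mu) C = 0.
Proof.
by move=> muK; apply: pos_variation_eq0 => K cK KC KO /=; rewrite muK// oppe0.
Qed.

End pos_variation.

(** * Cutoff sequences and limits of integrals *)

Section thickening.
Variables (R : realType) (N : nat).
Implicit Types (K V : set 'rV[R]_N) (s : seq ('rV[R]_N * R)).

(** Compactness gives one radius r for which all balls around K lie in V. Balls of half that radius
    leave room to take a closure. *)
Lemma compact_thickening K V : compact K -> open V -> K `<=` V ->
  exists2 r, 0 < r & exists K', [/\ compact K', K' `<=` V &
    forall x, K x -> ball x r `<=` K'].
Proof.
move=> cK oV KV.
have : \forall r \near (0 : R)^'+, K `<=` (fun x => ball x r `<=` V).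
  move/compact_near_coveringP : (cK) =>
    /(_ R (0 : R)^'+ (fun r x => ball x r `<=` V)).
  apply => x Kx.
  have /nbhs_ballP[e /= e0 eV] : nbhs x V.
    by apply: open_nbhs_nbhs; split=> //; exact: KV.
  have e2 : 0 < e / 2 by rewrite divr_gt0.
  exists (ball x (e / 2), [set r | r < e / 2]) => /=.
    by split; [exact: nbhsx_ballx|exact: nbhs_right_lt].
  move=> [y r] /= [xy re] z yz; apply: eV; rewrite (splitr e).
  by apply: ball_triangle xy _; exact: le_ball (ltW re) _ yz.
move=> nearr; have [r [/= r0 KrV]] := filter_ex (filterI (nbhs_right_gt 0) nearr).
have r2 : 0 < r / 2 by rewrite divr_gt0.
exists (r / 2) => //; exists (closure (\bigcup_(x in K) ball x (r / 2))); split.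
- apply: bounded_closed_compact; last exact: closed_closure.
  have [M [Mreal KM]] := compact_bounded cK.
  exists (M + 1 + r / 2 + r / 2); split; first by rewrite !realD// num_real.
  move=> L LM z clz.
  have /clz[y [[x Kx xy] zy]] : nbhs z (ball z (r / 2)) by exact: nbhsx_ballx.
  have xM : `|x| <= M + 1 by apply: KM => //; rewrite ltrDl.
  have := ltW LM; apply: le_trans.
  rewrite -(subrK y z) (le_trans (ler_normD _ _))// addrC lerD//; last first.
    by move: zy; rewrite -ball_normE /= => /ltW.
  rewrite -(subrK x y) (le_trans (ler_normD _ _))// addrC lerD//.
  by move: xy; rewrite -ball_normE /= distrC => /ltW.
- move=> z clz.
  have /clz[y [[x Kx xy] zy]] : nbhs z (ball z (r / 2)) by exact: nbhsx_ballx.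
  apply: (KrV _ Kx); rewrite (splitr r); apply: ball_triangle xy _.
  exact: ball_sym.
- by move=> x Kx y xy; apply: subset_closure; exists x.
Qed.

Lemma ball_cover_doubled (r : R) K s : ball_cover r K s ->
  doubled s `<=` \bigcup_(x in K) ball x (2 * r).
Proof.
move=> [sK _] y [z /= /sK[Kz /andP[_ zr]] zy]; exists z.1 => //.
by apply: (le_ball _ (eball_sub_ball zy)); rewrite ler_pM2l.
Qed.

Lemma open_doubled s : open (doubled s).
Proof. by apply: bigcup_open => z _; exact: open_eball. Qed.

Lemma doubled_closed_cvg (r : nat -> R) K (s : nat -> seq ('rV[R]_N * R)) x :
  closed K -> (forall n, ball_cover (r n) K (s n)) -> r n @[n --> \oo] --> 0 ->
  ~ K x -> \forall n \near \oo, ~ doubled (s n) x.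
Proof.
move=> clK sK r0 Kx.
have /nbhs_ballP[e /= e0 eK] : nbhs x (~` K).
  by apply: open_nbhs_nbhs; split=> //; rewrite openC.
have e2 : 0 < e / 2 by rewrite divr_gt0.
near=> n => /(ball_cover_doubled (sK n))[y Ky yx].
apply: (eK y) => //; apply: ball_sym; apply: (le_ball _ yx).
rewrite mulrC -ler_pdivlMr//.
have : `|r n| < e / 2 by near: n; exact: (cvgr0_norm_lt _ r0).
by move=> /ltW; apply: le_trans; exact: ler_norm.
Unshelve. all: by end_near. Qed.

Lemma cutoff_cvg_indic (r : nat -> R) K (s : nat -> seq ('rV[R]_N * R)) x :
  closed K -> (forall n, ball_cover (r n) K (s n)) -> r n @[n --> \oo] --> 0 ->
  cutoff (s n) x @[n --> \oo] --> (\1_K x : R).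
Proof.
move=> clK sK r0.
have s0 n z : z \in s n -> 0 < z.2 by move=> /((sK n).1 z)[_ /andP[]].
have [Kx|Kx] := pselect (K x).
  rewrite indicE mem_set//.
  rewrite (_ : (fun n => _) = cst 1); first exact: cvg_cst.
  apply/funext => n /=; have [z zs zx] := (sK n).2 _ Kx.
  exact: (cutoff_eq1 (s0 n) zs zx).
rewrite indicE memNset//.
apply: cvg_near_cst; have := doubled_closed_cvg clK sK r0 Kx.
by apply: filterS => n; apply: cutoff_eq0; exact: s0.
Qed.

Lemma indic_doubled_cvg (r : nat -> R) K (s : nat -> seq ('rV[R]_N * R)) x :
  closed K -> (forall n, ball_cover (r n) K (s n)) -> r n @[n --> \oo] --> 0 ->
  (\1_(doubled (s n)) x : R) @[n --> \oo] --> (\1_K x : R).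
Proof.
move=> clK sK r0.
have [Kx|Kx] := pselect (K x).
  rewrite indicE mem_set//.
  rewrite (_ : (fun n => _) = cst 1); first exact: cvg_cst.
  apply/funext => n /=; have [z zs zx] := (sK n).2 _ Kx.
  rewrite indicE mem_set//; exists z => //; apply: lt_trans zx _.
  have [_ /andP[z0 _]] := (sK n).1 _ zs.
  by rewrite ltr_pMl// ltr1n.
rewrite indicE memNset//.
apply: cvg_near_cst; have := doubled_closed_cvg clK sK r0 Kx.
by apply: filterS => n nx; rewrite indicE memNset.
Qed.

Lemma cutoff_test_function V (r : R) K K' s : compact K' -> K' `<=` V ->
  ball_cover r K s -> doubled s `<=` K' -> test_function V (cutoff s).
Proof.
move=> cK' K'V sK sK'.
have s0 z : z \in s -> 0 < z.2 by move=> /(sK.1 z)[_ /andP[]].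
split; first exact/elementary_smooth/elementary_cutoff.
have clK' : closed K' by exact: compact_closed_rV.
have sub : closure [set x | cutoff s x != 0] `<=` K'.
  rewrite [X in _ `<=` X](closure_id _).1//; apply: closureS => x /= /eqP sx.
  by apply: sK'; apply: contra_notP sx; exact: cutoff_eq0.
split; last exact: subset_trans K'V.
by apply: subclosed_compact sub => //; exact: closed_closure.
Qed.

End thickening.

Section measurability.
Variables (R : realType) (N : nat).

Lemma continuous_measurable_rV (f : 'rV[R]_N -> R) :
  continuous f -> measurable_fun setT f.
Proof.
move=> cf; apply: (measurability _ (RGenOpens.measurableE R)).
move=> _ [_ [a [b ->] <-]]; rewrite setTI; apply: open_measurable_rV.
by apply: open_comp => [v _|]; [exact: cf|exact: interval_open].
Qed.

Lemma elementary_measurable D (f : 'rV[R]_N -> R) :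
  elementary f -> measurable_fun D f.
Proof.
move=> ef; apply: (@measurable_funTS _ _ _ _ D f).
apply: continuous_measurable_rV => x.
exact/differentiable_continuous/elementary_differentiable.
Qed.

Lemma measurable_edot D (A B : 'rV[R]_N -> 'rV[R]_N) : measurable D ->
  measurable_fun D A -> (forall i, measurable_fun D (fun x => B x 0 i)) ->
  measurable_fun D (fun x => edot (A x) (B x)).
Proof.
move=> mD mA mB; apply: measurable_sum => i; apply: measurable_funM => //.
apply: (@measurableT_comp _ _ _ _ _ _ (fun v : 'rV[R]_N => v 0 i)) => //.
by apply: elementary_measurable; exact: elementary_coord.
Qed.

Lemma measurable_enorm D (A : 'rV[R]_N -> 'rV[R]_N) : measurable D ->
  measurable_fun D A -> measurable_fun D (fun x => enorm (A x)).
Proof.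
move=> mD mA; apply: (@measurableT_comp _ _ _ _ _ _ (@Num.sqrt R)) => //.
  exact: (continuous_measurable_fun (@sqrt_continuous R)).
apply: measurable_edot => // i.
apply: (@measurableT_comp _ _ _ _ _ _ (fun v : 'rV[R]_N => v 0 i)) => //.
by apply: elementary_measurable; exact: elementary_coord.
Qed.

End measurability.

Section integrals.
Context d (T : measurableType d) (R : realType).
Variable m : {measure set T -> \bar R}.
Implicit Types (D : set T).
Local Open Scope ereal_scope.

(* No measurability is required: the integral of a nonnegative function is
   defined as a supremum over simple functions.  This avoids having to show
   that the set of density points of E is measurable. *)
Lemma ge0_le_integral_nomeas D (f g : T -> \bar R) :
  (forall x, D x -> 0 <= f x) -> (forall x, D x -> f x <= g x) ->
  \int[m]_(x in D) f x <= \int[m]_(x in D) g x.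
Proof.
move=> f0 fg; have g0 x : D x -> 0 <= g x.
  by move=> Dx; exact: le_trans (f0 _ Dx) (fg _ Dx).
rewrite !ge0_integralE//; apply: le_ereal_sup => _ [h hf <-].
exists h => // x; apply: le_trans (hf x) _; rewrite /patch.
by case: ifPn => // /set_mem; exact: fg.
Qed.

Lemma integral_cvg_indic D K K' (f : nat -> T -> R) :
  measurable D -> measurable K -> measurable K' -> K `<=` D -> m K' < +oo ->
  (forall n, measurable_fun D (f n)) ->
  (forall n x, (0 <= f n x <= \1_K' x)%R) ->
  (forall x, (f n x @[n --> \oo] --> (\1_K x : R))%R) ->
  \int[m]_(x in D) (f n x)%:E @[n --> \oo] --> m K.
Proof.
move=> mD mK mK' KD mK'oo mf f01 fK.
have -> : m K = m (K `&` D) by rewrite (setIidl KD).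
rewrite -integral_indic//.
apply: (@dominated_cvg _ _ _ _ _ _ _ _ (fun x => (\1_K' x)%:E)) => //.
- by move=> n; exact/measurable_EFinP.
- by move=> x Dx; apply: cvg_EFin; [exact: nearW|exact: fK].
- apply/integrableP; split; first exact/measurable_EFinP.
  under eq_integral do rewrite /= ger0_norm//.
  rewrite integral_indic// (le_lt_trans _ mK'oo)//.
  by apply: le_measure; rewrite ?inE//; exact: measurableI.
- move=> n x Dx; have /andP[f0 f1] := f01 n x.
  by rewrite /= ger0_norm// lee_fin.
Qed.

Lemma normr_Rintegral_le D (f : T -> R) (e : R) : measurable D ->
  measurable_fun D f -> \int[m]_(x in D) `|f x|%:E <= e%:E ->
  (`|\int[m]_(x in D) f x| <= e)%R.
Proof.
move=> mD mf fe.
have h : `|\int[m]_(x in D) (f x)%:E| <= e%:E.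
  by apply: le_trans fe; apply: le_abse_integral => //; exact/measurable_EFinP.
rewrite /Rintegral -lee_fin -abse_EFin fineK//.
by rewrite -abse_fin_num ge0_fin_numE// (le_lt_trans h)// ltry.
Qed.

End integrals.

Section sradon_integral.
Variables (R : realType) (N : nat) (Omega : set 'rV[R]_N).
Hypothesis oOmega : open Omega.

Lemma sradon_integral_cvg (mu : sradon Omega) K K' (f : nat -> 'rV[R]_N -> R) :
  compact K -> K `<=` Omega -> compact K' -> K' `<=` Omega ->
  (forall n, measurable_fun Omega (f n)) ->
  (forall n x, 0 <= f n x <= \1_K' x) ->
  (forall x, f n x @[n --> \oo] --> (\1_K x : R)) ->
  sradon_integral mu (f n) @[n --> \oo] --> fine (mu K).
Proof.
move=> cK KO cK' K'O mf f01 fK.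
have mO : measurable Omega by exact: open_measurable_rV.
have rK := relatively_compact_compact cK KO.
have rK' := relatively_compact_compact cK' K'O.
have mK : measurable K.
  exact: compact_measurable_rV.
have mK' : measurable K'.
  exact: compact_measurable_rV.
have [pK nK muK] := sradon_jordan mu mK rK.
have [pK' nK' _] := sradon_jordan mu mK' rK'.
have fp := integral_cvg_indic mO mK mK' KO pK' mf f01 fK.
have fn := integral_cvg_indic mO mK mK' KO nK' mf f01 fK.
rewrite muK fineB; [|by rewrite ge0_fin_numE|by rewrite ge0_fin_numE].
by apply: cvgB; apply: fine_cvg; rewrite fineK ?ge0_fin_numE.
Qed.

End sradon_integral.

(** * Smallness of the integral of A against the gradients of the cutoffs *)

Section gradient_integral.
Variables (R : realType) (N : nat).
Implicit Types (K : set 'rV[R]_N) (s : seq ('rV[R]_N * R)).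

Lemma powR_mul_exprn (r q : R) n : 0 < r ->
  r `^ (- q) * r ^+ n = r `^ (n%:R - q).
Proof.
move=> r0; rewrite -powR_mulrn ?(ltW r0)// -powRD 1?addrC//.
by apply/implyP => _; rewrite gt_eqF.
Qed.

(** The volume of a ball is at most 2^N r^q r^(N-q): the factor r^q is uniformly small for fine
    covers, while the sum of the r^(N-q) stays bounded. *)
Lemma compact_hausdorff_leb_eq0 (q : R) K : 0 < q -> q <= N%:R -> compact K ->
  (hausdorff_measure (N%:R - q) K < +oo)%E -> leb N K = 0%E.
Proof.
move=> q0 qN cK HK; have a0 : 0 <= N%:R - q by rewrite subr_ge0.
have [M MP] := hausdorff_ball_cover cK a0 HK.
have mK : measurable K.
  exact: compact_measurable_rV.
apply/eqP; rewrite eq_le measure_ge0 andbT.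
apply/lee_addgt0Pr => e e0; rewrite add0e.
(* Chosen so that 2^N c (|M| + 1) = e; radii at most c^(1/q) then give r^q <= c. Replacing M by |M|
   + 1 ensures positivity. *)
pose c : R := e / (2 ^+ N * (`|M| + 1)).
have c0 : 0 < c by rewrite divr_gt0// mulr_gt0 ?exprn_gt0// ltr_wpDl.
have [s [sP Ks] sM] := MP (c `^ q^-1) (powR_gt0 _ c0).
have Kb : K `<=` \big[setU/set0]_(z <- s) eball z.1 z.2.
  by move=> x /Ks [z /= zs zx]; rewrite -bigcup_seq; exists z.
apply: (@le_trans _ _ (leb N (\big[setU/set0]_(z <- s) eball z.1 z.2))).
  apply: le_measure; rewrite ?inE//.
  by apply: bigsetU_measurable => z _; exact: measurable_eball.
apply: (@le_trans _ _ (\sum_(z <- s) (2 ^+ N * c * z.2 `^ (N%:R - q))%:E)%E).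
  elim: s sP {Ks sM Kb} => [|z s IH] sP; first by rewrite !big_nil measure0.
  have [_ /andP[z0 zc]] := sP z (mem_head _ _).
  rewrite !big_cons; apply: (@le_trans _ _ (leb N (eball z.1 z.2) +
      leb N (\big[setU/set0]_(z <- s) eball z.1 z.2))%E).
    apply: measureU2; first exact: measurable_eball.
    by apply: bigsetU_measurable => y _; exact: measurable_eball.
  apply: leeD; last by apply: IH => y ys; apply: sP; rewrite in_cons ys orbT.
  apply: (le_trans (leb_eball_le _ z0)); rewrite lee_fin exprMn -mulrA.
  rewrite ler_wpM2l ?exprn_ge0//.
  have -> : z.2 ^+ N = z.2 `^ q * z.2 `^ (N%:R - q).
    rewrite -powRD; first by rewrite addrC subrK powR_mulrn// ltW.
    by apply/implyP => _; rewrite gt_eqF.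
  rewrite ler_wpM2r ?powR_ge0//.
  have -> : c = (c `^ q^-1) `^ q by rewrite -powRrM mulVf ?gt_eqF// powRr1// ltW.
  by rewrite ge0_ler_powR ?nnegrE ?powR_ge0 ?(ltW z0) ?(ltW q0).
rewrite sumEFin lee_fin -mulr_sumr.
apply: (@le_trans _ _ (2 ^+ N * c * (`|M| + 1))).
  apply: ler_wpM2l; first by rewrite mulr_ge0 ?exprn_ge0// ltW.
  by apply: (le_trans sM); rewrite (le_trans (ler_norm _))// lerDl.
rewrite /c le_eqVlt; apply/orP; left; apply/eqP; field.
by rewrite expf_neq0//= gt_eqF// ltr_wpDl.
Qed.

(** The doubled ball has volume at most (4 r)^N, and r^(-q) r^N = r^(N-q): this is where the
    dimension N - q comes from. *)
Lemma integral_sum_eball_le (q : R) D s : measurable D ->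
  (forall z, z \in s -> 0 < z.2) ->
  (\int[leb N]_(x in D)
    (\sum_(z <- s) z.2 `^ (- q) * \1_(eball z.1 (2 * z.2)) x)%:E <=
  (4 ^+ N * \sum_(z <- s) z.2 `^ (N%:R - q))%:E)%E.
Proof.
move=> mD s0.
have mI (z : 'rV[R]_N * R) : measurable (eball z.1 (2 * z.2))
  by exact: measurable_eball.
under eq_integral do rewrite -sumEFin.
rewrite ge0_integral_sum//; last 2 first.
- by move=> z; apply/measurable_EFinP; apply: measurable_funM.
- by move=> z x _; rewrite lee_fin mulr_ge0 ?powR_ge0.
rewrite mulr_sumr -sumEFin big_seq [leRHS]big_seq; apply: lee_sum => z zs.
have z0 := s0 _ zs.
under eq_integral do rewrite EFinM.
rewrite ge0_integralZl_EFin ?powR_ge0//; last exact/measurable_EFinP.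
rewrite integral_indic//.
apply: (@le_trans _ _ ((z.2 `^ (- q))%:E * ((2 * (2 * z.2)) ^+ N)%:E)%E).
  apply: lee_pmul; rewrite ?lee_fin ?powR_ge0//.
  apply: le_trans (leb_eball_le z.1 _); last by rewrite mulr_gt0.
  by apply: le_measure; rewrite ?inE//; exact: measurableI.
rewrite -EFinM lee_fin mulrA -natrM exprMn mulrCA ler_wpM2l ?exprn_ge0//.
by rewrite powR_mul_exprn.
Qed.

Variables (Omega : set 'rV[R]_N) (p q : R) (A : 'rV[R]_N -> 'rV[R]_N).
Hypotheses (oOmega : open Omega) (p0 : 0 < p) (q0 : 0 < q)
  (pq : p^-1 + q^-1 = 1) (LA : Lp_loc Omega p A).

Let mO : measurable Omega. Proof. exact: open_measurable_rV. Qed.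

Let mAp : measurable_fun Omega (fun x => enorm (A x) `^ p).
Proof.
have [mA _] := LA.
apply: (@measurableT_comp _ _ _ _ _ _ (@powR R ^~ p)).
  exact: measurable_powR.
exact: measurable_enorm.
Qed.

(** Dominated convergence, with |A|^p on K' as the integrable bound; the limit is an integral over
    the null set K. *)
Lemma integral_powR_doubled_cvg0 K K' (r : nat -> R)
    (s : nat -> seq ('rV[R]_N * R)) :
  compact K -> K `<=` Omega -> compact K' -> K' `<=` Omega ->
  (forall n, ball_cover (r n) K (s n)) -> r n @[n --> \oo] --> 0 ->
  (forall n, doubled (s n) `<=` K') -> leb N K = 0%E ->
  (\int[leb N]_(x in Omega) (enorm (A x) `^ p * \1_(doubled (s n)) x)%:E
    @[n --> \oo] --> (0 : \bar R))%E.
Proof.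
move=> cK KO cK' K'O sK r0 sK' K0; have [mA Aoo] := LA.
have clK : closed K by exact: compact_closed_rV.
have clK' : closed K' by exact: compact_closed_rV.
have mK := closed_measurable_rV clK; have mK' := closed_measurable_rV clK'.
have mI (V : set 'rV[R]_N) : measurable V ->
    measurable_fun Omega (fun x => enorm (A x) `^ p * \1_V x).
  by move=> mV; apply: measurable_funM.
have iE (V : set 'rV[R]_N) : measurable V -> V `<=` Omega ->
    (\int[leb N]_(x in Omega) (enorm (A x) `^ p * \1_V x)%:E =
     \int[leb N]_(x in V) (enorm (A x) `^ p)%:E)%E.
  move=> mV VO; rewrite -[in RHS](setIidr VO) integral_mkcondr.
  apply: eq_integral => x _; rewrite patchE indicE.
  by case: (x \in V); rewrite ?mulr1 ?mulr0.
rewrite [X in _ --> X](_ : _ =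
    (\int[leb N]_(x in Omega) (enorm (A x) `^ p * \1_K x)%:E)%E); last first.
  rewrite iE// null_set_integral//.
  apply/measurable_EFinP; apply: measurable_funS mAp => //.
apply: (@dominated_cvg _ _ _ _ _ _ _ _
  (fun x => (enorm (A x) `^ p * \1_K' x)%:E)) => //.
- move=> n; apply/measurable_EFinP; apply: mI.
  by apply: open_measurable_rV; exact: open_doubled.
- move=> x Ox; apply: cvg_EFin; first exact: nearW.
  apply: cvgMr; exact: indic_doubled_cvg r0.
- apply/integrableP; split; first by apply/measurable_EFinP; exact: mI.
  under eq_integral do rewrite /= ger0_norm ?mulr_ge0 ?powR_ge0//.
  by rewrite iE//; exact: Aoo.
- move=> n x Ox; rewrite /= ger0_norm ?mulr_ge0 ?powR_ge0// lee_fin.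
  rewrite ler_wpM2l ?powR_ge0// !indicE ler_nat.
  by case: (boolP (x \in doubled _)) => // /set_mem /sK' /mem_set ->.
Qed.

Lemma gradient_cutoff_integral_cvg0 K K' (r : nat -> R)
    (s : nat -> seq ('rV[R]_N * R)) (M : R) :
  compact K -> K `<=` Omega -> compact K' -> K' `<=` Omega ->
  (forall n, ball_cover (r n) K (s n)) -> r n @[n --> \oo] --> 0 ->
  (forall n, doubled (s n) `<=` K') -> leb N K = 0%E ->
  (forall n, \sum_(z <- s n) z.2 `^ (N%:R - q) <= M) ->
  forall e, 0 < e -> \forall n \near \oo,
    (\int[leb N]_(x in Omega) `|edot (A x) (gradient (cutoff (s n)) x)|%:E
      <= e%:E)%E.
Proof.
move=> cK KO cK' K'O sK r0 sK' K0 sM e e0.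
have s0 n z : z \in s n -> 0 < z.2 by move=> /((sK n).1 z)[_ /andP[]].
set C := gradient_const N q.
have C0 : 0 <= C by exact: gradient_const_ge0.
pose c : R := (C + 1) * (4 ^+ N * (`|M| + 1)).
have c0 : 0 < c by rewrite !mulr_gt0 ?exprn_gt0// ltr_wpDl.
(* This t gives t^(-q) c = e / 2, which bounds the second Young term for every n; only then is n
   taken large, so that the first term is below e / 2. Using C + 1 in place of C avoids division by
   0. *)
pose t : R := (e / 2 / c) `^ (- q^-1).
have e2 : 0 < e / 2 by rewrite divr_gt0.
have t0 : 0 < t by rewrite powR_gt0// divr_gt0.
have tq : t `^ (- q) = e / 2 / c.
  by rewrite /t -powRrM mulrNN mulVf ?gt_eqF// powRr1// ltW// divr_gt0.
have h := integral_powR_doubled_cvg0 cK KO cK' K'O sK r0 sK' K0.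
pose b : R := e / 2 / ((C + 1) * t `^ p).
have C1 : 0 < C + 1 by rewrite ltr_wpDl.
have Ct0 : 0 < (C + 1) * t `^ p by apply: mulr_gt0 => //; exact: powR_gt0.
have Cq0 : 0 < (C + 1) * t `^ (- q) by apply: mulr_gt0 => //; exact: powR_gt0.
have b0 : 0 < b by rewrite divr_gt0.
have /(_ [set x | (x < b%:E)%E])[|n0 _ hn0] := h.
  by apply: open_nbhs_nbhs; split; [exact: open_ereal_lt_ereal|rewrite /= lte_fin].
exists n0 => // n /hn0 /= hn.
have mD : measurable (doubled (s n)).
  by apply: open_measurable_rV; exact: open_doubled.
apply: (@le_trans _ _ (\int[leb N]_(x in Omega)
  (((C + 1) * t `^ p)%:E * (enorm (A x) `^ p * \1_(doubled (s n)) x)%:E +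
   ((C + 1) * t `^ (- q))%:E *
     (\sum_(z <- s n) z.2 `^ (- q) * \1_(eball z.1 (2 * z.2)) x)%:E))%E).
  apply: ge0_le_integral_nomeas => [x _|x _]; first by rewrite lee_fin.
  rewrite -!EFinM -EFinD lee_fin.
  apply: (le_trans (ler_norm_edot_gradient_cutoff p0 q0 pq x (A x) (s0 n) t0)).
  rewrite -/C -![(C + 1) * _ * _]mulrA -[leRHS]mulrDr;
  apply: ler_wpM2r; last by rewrite lerDl.
  rewrite addr_ge0// ?mulr_ge0 ?powR_ge0// sumr_ge0// => z _.
  by rewrite mulr_ge0 ?powR_ge0.
have m1 : measurable_fun Omega
    (fun x => (enorm (A x) `^ p * \1_(doubled (s n)) x)%:E).
  by apply/measurable_EFinP; apply: measurable_funM.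
have m2 : measurable_fun Omega (fun x =>
    (\sum_(z <- s n) z.2 `^ (- q) * \1_(eball z.1 (2 * z.2)) x)%:E).
  apply/measurable_EFinP; apply: measurable_sum => z; apply: measurable_funM => //.
  by apply: measurable_indic; exact: measurable_eball.
have g0 x : 0 <= \sum_(z <- s n) z.2 `^ (- q) * \1_(eball z.1 (2 * z.2)) x.
  by apply: sumr_ge0 => z _; rewrite mulr_ge0 ?powR_ge0.
rewrite ge0_integralD//; last 4 first.
- move=> x _; rewrite -EFinM lee_fin.
  by apply: mulr_ge0; [exact: ltW|rewrite ?mulr_ge0 ?powR_ge0].
- exact: measurable_funeM.
- move=> x _; rewrite -EFinM lee_fin.
  by apply: mulr_ge0; [exact: ltW|rewrite ?mulr_ge0 ?powR_ge0].
- exact: measurable_funeM.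
rewrite ge0_integralZl_EFin ?(ltW Ct0)//; last first.
  by move=> x _; rewrite lee_fin mulr_ge0 ?powR_ge0.
rewrite ge0_integralZl_EFin ?(ltW Cq0)//; last first.
  by move=> x _; rewrite lee_fin.
rewrite (splitr e) EFinD; apply: leeD.
  rewrite -lee_pdivlMl ?(ltW hn)//.
  by rewrite -EFinM mulrC (le_trans (ltW hn)).
apply: (@le_trans _ _ (((C + 1) * t `^ (- q))%:E * (4 ^+ N * (`|M| + 1))%:E)%E).
  rewrite lee_pmul2l//.
  apply: (le_trans (integral_sum_eball_le _ mO (s0 n))).
  rewrite lee_fin; apply: ler_wpM2l; first exact: exprn_ge0.
  by apply: (le_trans (sM n)); rewrite (le_trans (ler_norm _))// lerDl.
rewrite -EFinM lee_fin tq mulrAC -/c mulrC divfK// gt_eqF//.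
Qed.

End gradient_integral.

(** * The pairing *)

Section density.
Variables (R : realType) (N : nat).
Implicit Types (E V : set 'rV[R]_N) (x y : 'rV[R]_N).

Lemma eball_sub_nbhs x V : open V -> V x ->
  exists2 e : R, 0 < e & eball x e `<=` V.
Proof.
move=> oV Vx; have /nbhs_ballP[e /= e0 eV] : nbhs x V by exact: open_nbhs_nbhs.
by exists e => //; exact: subset_trans (@eball_sub_ball _ _ _ _) eV.
Qed.

Lemma null_density E V x : measurable E -> open V -> leb N (E `&` V) = 0%E ->
  V x -> density1 (~` E) x /\ ~ density1 E x.
Proof.
move=> mE oV E0 Vx; have [e e0 eV] := eball_sub_nbhs oV Vx.
have mV : measurable V by exact: open_measurable_rV.
have Er r : r < e -> leb N (E `&` eball x r) = 0%E.
  move=> re; apply/eqP; rewrite eq_le measure_ge0 andbT -E0.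
  apply: le_measure; rewrite ?inE.
  - by apply: measurableI => //; exact: measurable_eball.
  - exact: measurableI.
  - apply: setIS => y xy; apply: eV; exact: lt_trans xy re.
have CEr r : r < e -> leb N (~` E `&` eball x r) = leb N (eball x r).
  move=> re; rewrite -[in RHS](setTI (eball x r)) -(setvU E) setIUl.
  rewrite measureU; first by rewrite [X in (_ + X)%E](Er _ re) adde0.
  - by apply: measurableI; [exact: measurableC|exact: measurable_eball].
  - by apply: measurableI => //; exact: measurable_eball.
  - by rewrite setIACA setICl set0I.
split.
  apply: cvg_near_cst; near=> r.
  rewrite CEr//; rewrite divff// gt_eqF// fine_gt0// leb_eball_gt0//=.
  by rewrite -ge0_fin_numE ?leb_eball_fin_num.
have c0 : fine (leb N (E `&` eball x r)) / fine (leb N (eball x r)) @[r --> 0^'+] --> (0 : R).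
  by apply: cvg_near_cst; near=> r; rewrite Er ?mul0r.
move=> c1; have e10 : (1 : R) = 0.
  by apply: cvg_unique c1 c0; exact: norm_hausdorff.
by move/eqP: e10; rewrite oner_eq0.
Unshelve. all: by end_near. Qed.

Lemma lambda_rep_null (lambda : 'rV[R]_N -> R) E V x : measurable E -> open V ->
  leb N (E `&` V) = 0%E -> V x -> lambda_rep lambda E x = 0.
Proof.
move=> mE oV E0 Vx; have [dC dE] := null_density mE oV E0 Vx.
rewrite /lambda_rep !indicE memNset// memNset ?mulr0 ?addr0//.
by move=> /(_ (or_intror dC)).
Qed.

Lemma lambda_rep_full (lambda : 'rV[R]_N -> R) E V x : measurable E -> open V ->
  leb N (~` E `&` V) = 0%E -> V x -> lambda_rep lambda E x = 1.
Proof.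
move=> mE oV E0 Vx; have [dE _] := null_density (measurableC mE) oV E0 Vx.
rewrite setCK in dE.
rewrite /lambda_rep !indicE mem_set// memNset ?mulr0 ?addr0//.
by move=> /(_ (or_introl dE)).
Qed.

Lemma not_minus_boundary E x : measurable E -> ~ minus_boundary E x ->
  exists2 r : R, 0 < r &
    leb N (E `&` eball x r) = 0%E \/ leb N (~` E `&` eball x r) = 0%E.
Proof.
move=> mE /existsNP[r /not_implyP[r0 /negP]]; rewrite negb_and.
have mEr : measurable (E `&` eball x r).
  by apply: measurableI => //; exact: measurable_eball.
move=> Er; exists r => //; case/orP : Er.
  by rewrite -leNgt => h; left; apply/eqP; rewrite eq_le h measure_ge0.
rewrite -leNgt => h; right.
have efin : leb N (eball x r) \is a fin_num by exact: leb_eball_fin_num.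
have := measureU (leb N) mEr (measurableI _ _ (measurableC mE)
  (measurable_eball x r)).
rewrite setIACA setICr set0I => /(_ erefl).
rewrite -setIUl setUv setTI => eE.
have Efin : leb N (E `&` eball x r) \is a fin_num.
  rewrite ge0_fin_numE// (le_lt_trans _ (_ : leb N (eball x r) < +oo)%E)//.
    by apply: le_measure; rewrite ?inE//; exact: measurable_eball.
  by rewrite -ge0_fin_numE.
have : (leb N (E `&` eball x r) + leb N (~` E `&` eball x r) <=
        leb N (E `&` eball x r))%E by rewrite -eE.
rewrite -leeBrDl// subee// => h'; apply/eqP; rewrite eq_le h' measure_ge0//.
Qed.

End density.

Lemma hausdorff_measureS (R : realType) (N : nat) (alpha : R) (C D : set 'rV[R]_N) :
  C `<=` D -> (hausdorff_measure alpha C <= hausdorff_measure alpha D)%E.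
Proof.
move=> CD; apply: ge_ereal_sup => _ [delta /= d0 <-].
apply: (@le_trans _ _ (hausdorff_premeasure alpha delta D)).
  apply: le_ereal_inf => _ [F [DF dF] <-]; exists F => //; split=> //.
  exact: subset_trans CD DF.
by apply: ereal_sup_ubound; exists delta.
Qed.

Lemma measure_bigsetU_eq0 d (T : measurableType d) (R : realType)
    (m : {measure set T -> \bar R}) (I : eqType) (s : seq I) (F : I -> set T) :
  (forall i, i \in s -> measurable (F i) /\ m (F i) = 0%E) ->
  m (\big[setU/set0]_(i <- s) F i) = 0%E.
Proof.
elim: s => [|i s IH] mF; first by rewrite big_nil measure0.
have mFs j : j \in s -> measurable (F j) /\ m (F j) = 0%E.
  by move=> js; apply: mF; rewrite in_cons js orbT.
have [mi i0] := mF _ (mem_head _ _).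
apply/eqP; rewrite eq_le measure_ge0 andbT big_cons.
apply: (@le_trans _ _ (m (F i) + m (\big[setU/set0]_(j <- s) F j))%E).
  apply: measureU2 => //; rewrite big_seq.
  by apply: bigsetU_measurable => j /mFs[].
by rewrite i0 IH// adde0.
Qed.

Section cutoff_sequence.
Variables (R : realType) (N : nat) (Omega : set 'rV[R]_N).
Hypothesis oOmega : open Omega.
Implicit Types (K V : set 'rV[R]_N).

(** The predicate P carries the bound on the sum of the r^(N-q) in the Hausdorff case, and is
    trivial where E is locally null or full. *)
Lemma cutoff_sequence K V (P : seq ('rV[R]_N * R) -> Prop) :
  compact K -> open V -> K `<=` V ->
  (forall r, 0 < r -> exists2 s, ball_cover r K s & P s) ->
  exists K' (r : nat -> R) (s : nat -> seq ('rV[R]_N * R)),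
  [/\ compact K', K' `<=` V, r n @[n --> \oo] --> 0,
      forall n, ball_cover (r n) K (s n) /\ P (s n) &
      forall n, doubled (s n) `<=` K'].
Proof.
move=> cK oV KV exs.
have [r r0 [K' [cK' K'V KK']]] := compact_thickening cK oV KV.
(* Half of r because the balls get doubled: the doubled radii r / (n+1) stay within the
   thickening. *)
pose u n : R := r / 2 * n.+1%:R^-1.
have u0 n : 0 < u n by rewrite mulr_gt0 ?divr_gt0// invr_gt0.
have /choice[s sP] : forall n, exists s, ball_cover (u n) K s /\ P s.
  by move=> n; have [s sK sP] := exs _ (u0 n); exists s.
exists K', u, s; split=> // [|n].
  rewrite -[X in _ --> X](mulr0 (r / 2)); apply: cvgMr.
  exact: cvg_harmonic.
move=> x /(ball_cover_doubled (sP n).1)[y Ky yx]; apply: (KK' _ Ky).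
apply: le_ball yx; rewrite /u mulrA [2 * _]mulrC divfK//.
by rewrite ler_piMr ?(ltW r0)// invf_le1// ler1n.
Qed.

Lemma sradon_cutoff_cvg (mu : sradon Omega) K K' (r : nat -> R) s :
  compact K -> K `<=` Omega -> compact K' -> K' `<=` Omega ->
  (forall n, ball_cover (r n) K (s n)) -> r n @[n --> \oo] --> 0 ->
  (forall n, doubled (s n) `<=` K') ->
  sradon_integral mu (cutoff (s n)) @[n --> \oo] --> fine (mu K).
Proof.
move=> cK KO cK' K'O sK r0 sK'.
have clK : closed K by exact: compact_closed_rV.
have s0 n z : z \in s n -> 0 < z.2 by move=> /((sK n).1 z)[_ /andP[]].
apply: (@sradon_integral_cvg _ _ _ oOmega mu K K' (fun n => cutoff (s n))) => //.
- by move=> n; apply: elementary_measurable; exact: elementary_cutoff.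
- move=> n x; rewrite cutoff_ge0/= indicE.
  case: (boolP (x \in K')) => [_|]; first exact: cutoff_le1.
  rewrite notin_setE => xK'; rewrite (cutoff_eq0 (s0 n))// => sx.
  exact/xK'/(sK' n).
- by move=> x; exact: cutoff_cvg_indic r0.
Qed.

Lemma gradient_cutoff_eq0 (r : R) K s x : ball_cover r K s -> ~ doubled s x ->
  gradient (cutoff s) x = 0.
Proof.
move=> sK sx; apply/rowP => i; rewrite !mxE partial_cutoff big1_seq ?mulr0//
  => z /= zs.
have [_ /andP[z0 _]] := sK.1 _ zs.
rewrite partial_bump gexp_le0 ?mul0r// leNgt bump_arg_gt0//.
by apply/negP => zx; apply: sx; exists z.
Qed.

Lemma measurable_edot_gradient_cutoff (A : 'rV[R]_N -> 'rV[R]_N) s :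
  measurable_fun Omega A ->
  measurable_fun Omega (fun x => edot (A x) (gradient (cutoff s) x)).
Proof.
move=> mA; apply: measurable_edot => //; first exact: open_measurable_rV.
move=> i; rewrite (_ : (fun _ => _) = partial i (cutoff s)).
  by apply: elementary_measurable; apply: elementary_partial;
    exact: elementary_cutoff.
by apply/funext => x; rewrite mxE.
Qed.

End cutoff_sequence.

(** * Vanishing of the divergence and of the pairing on compact sets *)

Section pairing_vanishing.
Variables (R : realType) (N : nat) (Omega : set 'rV[R]_N) (p q : R).
Variables (A : 'rV[R]_N -> 'rV[R]_N) (divA : sradon Omega).
Hypotheses (oOmega : open Omega) (p0 : 0 < p) (q0 : 0 < q) (qN : q <= N%:R)
  (pq : p^-1 + q^-1 = 1) (DA : DM_loc p A divA).
Implicit Types (K V : set 'rV[R]_N).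

Let mO : measurable Omega. Proof. exact: open_measurable_rV. Qed.

Let hausdorff_finite K := (hausdorff_measure (N%:R - q) K < +oo)%E.

Lemma sradon_compact_fine_eq0 (mu : sradon Omega) K :
  compact K -> K `<=` Omega -> fine (mu K) = 0 -> mu K = 0%E.
Proof.
move=> cK KO muK; rewrite -[mu K]fineK ?muK//; apply: sradon_fin_num.
  exact: compact_measurable_rV.
exact: relatively_compact_compact.
Qed.

(* On a compact set of finite (N-q)-dimensional Hausdorff measure, the cutoffs
   have gradients bounded in L^q, while A is small in L^p on their supports. *)
Lemma hausdorff_cutoff_sequence K : compact K -> K `<=` Omega ->
  hausdorff_finite K ->
  exists K' (r : nat -> R) (s : nat -> seq ('rV[R]_N * R)),
  [/\ compact K' /\ K' `<=` Omega, r n @[n --> \oo] --> 0,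
      forall n, ball_cover (r n) K (s n), forall n, doubled (s n) `<=` K' &
      forall e, 0 < e -> \forall n \near \oo,
        (\int[leb N]_(x in Omega)
          `|edot (A x) (gradient (cutoff (s n)) x)|%:E <= e%:E)%E].
Proof.
move=> cK KO HK; have a0 : 0 <= N%:R - q by rewrite subr_ge0.
have [M MP] := hausdorff_ball_cover cK a0 HK.
have [K' [r [s [cK' K'O r0 sP sK']]]] := cutoff_sequence cK oOmega KO MP.
have sK n := (sP n).1; have sM n := (sP n).2.
exists K', r, s; split=> //.
apply: (gradient_cutoff_integral_cvg0 oOmega p0 q0 pq (proj1 DA)
  cK KO cK' K'O sK r0 sK' _ sM).
exact: compact_hausdorff_leb_eq0 HK.
Qed.

Lemma divergence_hausdorff_eq0 K : compact K -> K `<=` Omega ->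
  hausdorff_finite K -> divA K = 0%E.
Proof.
move=> cK KO HK.
have [K' [r [s [[cK' K'O] r0 sK sK' sA]]]] := hausdorff_cutoff_sequence cK KO HK.
have [[mA _] dA] := DA.
have c1 := @sradon_cutoff_cvg _ _ _ oOmega divA K K' r s cK KO cK' K'O sK r0 sK'.
have c0 : sradon_integral divA (cutoff (s n)) @[n --> \oo] --> (0 : R).
  apply/cvgr0Pnorm_le => e /sA; apply: filterS => n en.
  rewrite dA; last exact: (cutoff_test_function cK' K'O (sK n) (sK' n)).
  rewrite normrN; apply: normr_Rintegral_le => //.
  exact: measurable_edot_gradient_cutoff.
apply: sradon_compact_fine_eq0 => //.
by apply: cvg_unique c1 c0; exact: norm_hausdorff.
Qed.

Variables (lambda : 'rV[R]_N -> R) (E : set 'rV[R]_N) (P : sradon Omega).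
Hypotheses (lambda01 : forall x, Omega x -> 0 <= lambda x <= 1)
  (mE : measurable E) (EP : is_pairing_measure A divA lambda E P).

Lemma lambda_rep_ge0 x : Omega x -> 0 <= lambda_rep lambda E x.
Proof. by move=> /lambda01/andP[l0 _]; rewrite /lambda_rep addr_ge0// mulr_ge0. Qed.

Lemma lambda_rep_le1 x : Omega x -> lambda_rep lambda E x <= 1.
Proof.
move=> /lambda01/andP[l0 l1]; rewrite /lambda_rep !indicE.
case: (boolP (x \in density1 E)) => [/set_mem xE|_].
  by rewrite memNset ?mulr0 ?addr0// => /(_ (or_introl xE)).
by rewrite add0r; case: (x \in _); rewrite ?mulr1 ?mulr0.
Qed.

(** Since 0 <= [lambda_rep] <= 1 on Omega, the integral is squeezed between 0 and that of [f n],
    which tends to m K = 0. *)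
Lemma integral_lambda_rep_cvg0 (m : {measure set 'rV[R]_N -> \bar R}) K K'
    (f : nat -> 'rV[R]_N -> R) :
  compact K -> K `<=` Omega -> compact K' -> K' `<=` Omega -> (m K' < +oo)%E ->
  (forall n, measurable_fun Omega (f n)) ->
  (forall n x, 0 <= f n x <= \1_K' x) ->
  (forall x, f n x @[n --> \oo] --> (\1_K x : R)) -> m K = 0%E ->
  \int[m]_(x in Omega) (lambda_rep lambda E x * f n x) @[n --> \oo] --> (0 : R).
Proof.
move=> cK KO cK' K'O mK'oo mf f01 fK mK0.
have mK : measurable K.
  exact: compact_measurable_rV.
have mK' : measurable K'.
  exact: compact_measurable_rV.
have := integral_cvg_indic mO mK mK' KO mK'oo mf f01 fK.
rewrite mK0 => c0; apply: fine_cvg.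
apply: (@squeeze_cvge _ _ _ _ (cst 0%E) _
  (fun n => \int[m]_(x in Omega) (f n x)%:E)%E) => //.
  apply: nearW => n /=; apply/andP; split.
    apply: integral_ge0 => x Ox; have /andP[f0 _] := f01 n x.
    by rewrite lee_fin mulr_ge0// lambda_rep_ge0.
  apply: ge0_le_integral_nomeas => x Ox; have /andP[f0 _] := f01 n x.
    by rewrite lee_fin mulr_ge0// lambda_rep_ge0.
  by rewrite lee_fin ler_piMl// lambda_rep_le1.
exact: cvg_cst.
Qed.

Lemma pairing_hausdorff_eq0 K : compact K -> K `<=` Omega ->
  hausdorff_finite K -> P K = 0%E.
Proof.
move=> cK KO HK.
have [K' [r [s [[cK' K'O] r0 sK sK' sA]]]] := hausdorff_cutoff_sequence cK KO HK.
have [[mA _] dA] := DA.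
have c1 := @sradon_cutoff_cvg _ _ _ oOmega P K K' r s cK KO cK' K'O sK r0 sK'.
have clK : closed K by exact: compact_closed_rV.
have s0 n z : z \in s n -> 0 < z.2 by move=> /((sK n).1 z)[_ /andP[]].
(* That divA K = 0 could hide a cancellation between the Jordan parts; vanishing on every compact
   subset of K makes both parts vanish on K. *)
have divA0 K1 : compact K1 -> K1 `<=` K -> K1 `<=` Omega -> divA K1 = 0%E.
  move=> cK1 K1K K1O; apply: divergence_hausdorff_eq0 => //.
  exact: le_lt_trans (hausdorff_measureS _ K1K) HK.
have rK' := relatively_compact_compact cK' K'O.
have mK' : measurable K'.
  exact: compact_measurable_rV.
have [pK' nK' _] := sradon_jordan divA mK' rK'.
have cI (m : {measure set 'rV[R]_N -> \bar R}) : (m K' < +oo)%E -> m K = 0%E ->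
    \int[m]_(x in Omega) (lambda_rep lambda E x * cutoff (s n) x) @[n --> \oo] --> (0 : R).
  move=> mK'oo mK0; apply: (@integral_lambda_rep_cvg0 m K K') => //.
  - by move=> n; apply: elementary_measurable; exact: elementary_cutoff.
  - move=> n x; rewrite cutoff_ge0/= indicE.
    case: (boolP (x \in K')) => [_|]; first exact: cutoff_le1.
    rewrite notin_setE => xK'; rewrite (cutoff_eq0 (s0 n))// => sx.
    exact/xK'/(sK' n).
  - by move=> x; exact: cutoff_cvg_indic r0.
have cD : sradon_integral divA (fun x => lambda_rep lambda E x * cutoff (s n) x)
    @[n --> \oo] --> (0 : R).
  rewrite -[X in _ --> X](subrr (0 : R)); apply: cvgB; apply: cI => //.
    exact: pos_variation_eq0.
  exact: pos_variation_opp_eq0.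
have cE : \int[leb N]_(x in Omega) (\1_E x * edot (A x) (gradient (cutoff (s n)) x))
    @[n --> \oo] --> (0 : R).
  apply/cvgr0Pnorm_le => e /sA; apply: filterS => n en.
  apply: normr_Rintegral_le => //.
    by apply: measurable_funM => //; exact: measurable_edot_gradient_cutoff.
  apply: le_trans en; apply: ge0_le_integral_nomeas => x _; rewrite lee_fin//.
  by rewrite normrM ler_piMl// indicE; case: (x \in E); rewrite ?normr1 ?normr0.
have c0 : sradon_integral P (cutoff (s n)) @[n --> \oo] --> (0 : R).
  rewrite [X in X @ _](_ : _ = (fun n => pairing A divA lambda E (cutoff (s n)))).
    rewrite -[X in _ --> X](subrr (0 : R)) -{1}oppr0.
    by apply: cvgB => //; exact: cvgN.
  apply/funext => n; rewrite EP//.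
  exact: (cutoff_test_function cK' K'O (sK n) (sK' n)).
apply: sradon_compact_fine_eq0 => //.
by apply: cvg_unique c1 c0; exact: norm_hausdorff.
Qed.

Lemma Rintegral_ae_eq (D Z : set 'rV[R]_N) (f g : 'rV[R]_N -> R) :
  measurable D -> measurable Z -> leb N Z = 0%E ->
  measurable_fun D f -> measurable_fun D g ->
  (forall x, D x -> ~ Z x -> f x = g x) ->
  \int[leb N]_(x in D) f x = \int[leb N]_(x in D) g x.
Proof.
move=> mD mZ Z0 mf mg fg; congr fine.
apply: ae_eq_integral => //; [exact/measurable_EFinP|exact/measurable_EFinP|].
exists Z; split=> // x /= /not_implyP[Dx]; apply: contra_notP => Zx.
by rewrite fg.
Qed.

(** If E is null in V, both [lambda_rep] and, almost everywhere, the indicator of E vanish there. If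
    E has full measure in V, both are replaced by 1, and the two terms of the pairing cancel by the
    definition of the divergence. *)
Lemma pairing_null_or_full_eq0 V K : open V -> V `<=` Omega ->
  leb N (E `&` V) = 0%E \/ leb N (~` E `&` V) = 0%E ->
  compact K -> K `<=` V -> P K = 0%E.
Proof.
move=> oV VO EV cK KV; have KO := subset_trans KV VO.
have [|K' [r [s [cK' K'V r0 sP sK']]]] :=
  @cutoff_sequence _ _ K V (fun=> True) cK oV KV.
  by move=> r r0; have [s sK] := compact_ball_cover cK r0; exists s.
have sK n := (sP n).1; have K'O := subset_trans K'V VO.
have s0 n z : z \in s n -> 0 < z.2 by move=> /((sK n).1 z)[_ /andP[]].
have [[mA _] dA] := DA.
have mV : measurable V by exact: open_measurable_rV.
have c1 := @sradon_cutoff_cvg _ _ _ oOmega P K K' r s cK KO cK' K'O sK r0 sK'.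
have sV n x : ~ V x -> ~ doubled (s n) x by move=> Vx /sK' /K'V.
have fV n x : ~ V x -> cutoff (s n) x = 0.
  by move=> /(sV n); apply: cutoff_eq0; exact: s0.
have gV n x : ~ V x -> edot (A x) (gradient (cutoff (s n)) x) = 0.
  move=> /(sV n) sx; rewrite (gradient_cutoff_eq0 (sK n) sx).
  by rewrite /edot big1// => i _; rewrite mxE mulr0.
have mg n := measurable_edot_gradient_cutoff oOmega (s n) mA.
have tn n := cutoff_test_function cK' K'O (sK n) (sK' n).
apply: sradon_compact_fine_eq0 => //.
suff c0 : sradon_integral P (cutoff (s n)) @[n --> \oo] --> (0 : R).
  by apply: cvg_unique c1 c0; exact: norm_hausdorff.
rewrite (_ : (fun n => _) = cst 0); first exact: cvg_cst.
apply/funext => n /=; rewrite -EP// /pairing.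
case: EV => EV.
  rewrite (_ : (fun x => _) = cst 0); last first.
    apply/funext => x /=; have [Vx|Vx] := pselect (V x).
      by rewrite (lambda_rep_null _ mE oV EV Vx) mul0r.
    by rewrite fV// mulr0.
  rewrite (@Rintegral_ae_eq _ (E `&` V) _ (cst 0))//.
  - rewrite /sradon_integral !Rintegral_cst// !mul0r.
    by rewrite !(subrr, oppr0, addr0).
  - exact: measurableI.
  - by apply: measurable_funM.
  - move=> x Ox EVx; rewrite indicE.
    case: (boolP (x \in E)) => [/set_mem xE|]; last by rewrite mul0r.
    by rewrite gV ?mulr0// => Vx; apply: EVx.
rewrite (_ : (fun x => _) = cutoff (s n)); last first.
  apply/funext => x /=; have [Vx|Vx] := pselect (V x).
    by rewrite (lambda_rep_full _ mE oV EV Vx) mul1r.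
  by rewrite fV// mulr0.
rewrite dA// opprK.
rewrite (@Rintegral_ae_eq _ (~` E `&` V)
  (fun x => \1_E x * edot (A x) (gradient (cutoff (s n)) x))
  (fun x => edot (A x) (gradient (cutoff (s n)) x)))// ?subrr//.
- by apply: measurableI => //; exact: measurableC.
- exact: measurable_funM.
- move=> x Ox EVx; have [Vx|Vx] := pselect (V x); last by rewrite gV// mulr0.
  rewrite indicE mem_set ?mul1r//.
  by apply: contra_notP EVx.
Qed.

(** The union of this family is open, hence Borel, and contains the part of Omega outside
    [minus_boundary E]; it is the set used to split B. *)
Definition null_or_full : set (set 'rV[R]_N) := [set V | [/\ open V, V `<=` Omega &
  leb N (E `&` V) = 0%E \/ leb N (~` E `&` V) = 0%E]].

Lemma bigcup_null_or_full_minus_boundary :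
  Omega `\` minus_boundary E `<=` \bigcup_(V in null_or_full) V.
Proof.
move=> x [Ox /(not_minus_boundary mE)[r r0 Er]].
have [e e0 eO] := eball_sub_nbhs oOmega Ox.
exists (eball x (Num.min r e)); last by apply: eball_center; rewrite lt_min r0.
split; first exact: open_eball.
  by apply: subset_trans eO => y; rewrite /eball/= lt_min => /andP[].
have sub (X : set 'rV[R]_N) : measurable X -> leb N (X `&` eball x r) = 0%E ->
    leb N (X `&` eball x (Num.min r e)) = 0%E.
  move=> mX X0; apply/eqP; rewrite eq_le measure_ge0 andbT -X0.
  apply: le_measure; rewrite ?inE.
  - by apply: measurableI => //; exact: measurable_eball.
  - by apply: measurableI => //; exact: measurable_eball.
  - by apply: setIS => y; rewrite /eball/= lt_min => /andP[].
by case: Er => Er; [left|right]; apply: sub => //; exact: measurableC.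
Qed.

(** A compact K is covered by finitely many members of the family. These overlap, so subadditivity
    is used for the two Jordan parts of P, each null on every member. *)
Lemma pairing_bigcup_null_or_full_eq0 K : compact K ->
  K `<=` \bigcup_(V in null_or_full) V -> P K = 0%E.
Proof.
move=> cK KG.
have /choice[V VP] : forall x, exists V, K x -> null_or_full V /\ V x.
  move=> x; have [/KG[V gV Vx]|Kx] := pselect (K x); first by exists V.
  by exists set0.
move: (cK); rewrite compact_cover => /(_ _ K V)[x Kx|x Kx|D DK KD].
- by have [[]] := VP x Kx.
- by exists x => //; have [] := VP x Kx.
have mV x : x \in finmap.enum_fset D -> measurable (V x).
  move=> xD; have [[oV _ _] _] := VP x (set_mem (DK _ xD)).
  exact: open_measurable_rV.
have KV : K `<=` \big[setU/set0]_(x <- finmap.enum_fset D) V x.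
  by move=> x /KD[y /= yD xy]; rewrite -bigcup_seq; exists y.
have KO : K `<=` Omega by move=> x /KG[W [_ WO _] Wx]; exact: WO.
have V0 x W : x \in finmap.enum_fset D -> compact W -> W `<=` V x ->
    W `<=` Omega -> P W = 0%E.
  move=> xD cW WV _; have [[oV VO EV] _] := VP x (set_mem (DK _ xD)).
  exact: pairing_null_or_full_eq0 EV cW WV.
have mK : measurable K.
  exact: compact_measurable_rV.
have [_ _ ->] := sradon_jordan P mK (relatively_compact_compact cK KO).
have K0 (m : {measure set 'rV[R]_N -> \bar R}) :
    (forall x, x \in finmap.enum_fset D -> m (V x) = 0%E) -> m K = 0%E.
  move=> mV0; apply/eqP; rewrite eq_le measure_ge0 andbT.
  rewrite -(@measure_bigsetU_eq0 _ _ _ m _ (finmap.enum_fset D) V); last first.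
    by move=> x xD; split; [exact: mV|exact: mV0].
  apply: le_measure; rewrite ?inE// big_seq.
  by apply: bigsetU_measurable => x; exact: mV.
rewrite (K0 (pos_variation P)); last first.
  by move=> x xD; apply: pos_variation_eq0 => W cW WV WO; exact: V0 xD cW WV WO.
rewrite (K0 (pos_variation (sradon_opp P))) ?subee//.
by move=> x xD; apply: pos_variation_opp_eq0 => W cW WV WO; exact: V0 xD cW WV WO.
Qed.

(** The measure m stands for either Jordan part of P, and its first hypothesis is the reduction to
    compact sets. Outside the open set G, a compact subset of a piece X i lies in
    [minus_boundary E], hence has finite Hausdorff measure. *)
Lemma pairing_variation_eq0 (m : {measure set 'rV[R]_N -> \bar R}) B :
  (forall C, (forall K, compact K -> K `<=` C -> K `<=` Omega -> P K = 0%E) ->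
    m C = 0%E) ->
  measurable B -> B `<=` Omega ->
  sigma_finite B
    (fun X => hausdorff_measure (N%:R - q) (X `&` minus_boundary E)) ->
  m B = 0%E.
Proof.
move=> mP mB BO [X BX Xoo].
set G := \bigcup_(V in null_or_full) V.
have mG : measurable G.
  by apply: open_measurable_rV; apply: bigcup_open => V [].
have mX i : measurable (X i) by have [] := Xoo i.
have mXG i : measurable (X i `\` G) by exact: measurableD.
have XO i : X i `<=` Omega by apply: subset_trans BO; rewrite BX; exact: bigcup_sup.
have mBG : m (B `&` G) = 0%E.
  by apply: mP => K cK KBG _; apply: pairing_bigcup_null_or_full_eq0 => // x /KBG[].
have mXG0 i : m (X i `\` G) = 0%E.
  apply: mP => K cK KX KO; apply: pairing_hausdorff_eq0 => //.
  have [_] := Xoo i; apply: le_lt_trans; apply: hausdorff_measureS => x /KX[Xx Gx].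
  split=> //; apply: contra_notP Gx => Ex.
  by apply: bigcup_null_or_full_minus_boundary; split=> //; exact: XO Xx.
apply/eqP; rewrite eq_le measure_ge0 andbT -(setUIDK B G).
apply: (@le_trans _ _ (m (B `&` G) + m (B `\` G))%E).
  by apply: measureU2; [exact: measurableI|exact: measurableD].
rewrite mBG add0e (_ : 0%E = \sum_(i <oo) m (X i `\` G))%E; last first.
  by rewrite eseries0.
apply: measure_sigma_subadditive => //; first exact: measurableD.
by rewrite BX setD_bigcupl.
Qed.

End pairing_vanishing.

(** [radon_variation] is a supremum over partitions into relatively compact pieces; one must exist
    for its value to be 0 and not minus infinity. The pieces come from inner cores of Omega cut by
    closed balls and made disjoint. *)
Lemma exists_compact_partition (R : realType) (N : nat) (Omega B : set 'rV[R]_N) :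
  open Omega -> measurable B -> B `<=` Omega ->
  exists F : (set 'rV[R]_N)^nat,
  [/\ forall i, measurable (F i) /\ relatively_compact Omega (F i),
      trivIset setT F & B = \bigcup_i F i].
Proof.
move=> oO mB BO.
pose core n := inner_core Omega n `&` closed_ball (0 : 'rV[R]_N) n.+1%:R.
exists (seqDU (fun n => B `&` core n)).
have clcore n : closed (core n).
  by apply: closedI; [exact: closed_inner_core|exact: closed_ball_closed].
have mBc n : measurable (B `&` core n).
  by apply: measurableI => //; exact: closed_measurable_rV.
split.
- move=> i; split.
    by apply: measurableD => //; apply: bigsetU_measurable => j _; exact: mBc.
  apply: (@relatively_compactS _ _ _ _ (core i)).
    by move=> x [[]].
  apply: relatively_compact_compact.
    apply: bounded_closed_compact => //.
    exists i.+1%:R; split; first exact: num_real.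
    move=> M iM x [_]; rewrite closed_ballE// /closed_ball_/= sub0r normrN => xi.
    exact: le_trans xi (ltW iM).
  by move=> x [/inner_core_sub].
- exact: trivIset_seqDU.
rewrite -seqDU_bigcup_eq; apply/seteqP; split=> [x Bx|x [n _ []]//].
have := BO _ Bx; rewrite -(bigcup_inner_core oO) => -[n _ nx].
have [k xk] : exists k : nat, `|x| <= k%:R.
  by exists (Num.truncn `|x|).+1; rewrite ltW// truncnS_gt.
exists (maxn n k) => //; split=> //; split.
  exact: inner_core_homo (leq_maxl _ _) _ nx.
rewrite closed_ballE// /closed_ball_/= sub0r normrN (le_trans xk)// ler_nat.
by rewrite leqW// leq_maxr.
Qed.

Theorem proposition7p11 (R : realType) (N : nat) (Omega : set 'rV[R]_N)
    (p q : R) (A : 'rV[R]_N -> 'rV[R]_N) (divA : sradon Omega)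
    (lambda : 'rV[R]_N -> R) (E : set 'rV[R]_N) :
  (2 <= N)%N -> open Omega -> Omega !=set0 ->
  N%:R / (N%:R - 1) <= p -> 1 < q -> q <= N%:R -> p^-1 + q^-1 = 1 ->
  DM_loc p A divA ->
  measurable_fun Omega lambda ->
  (forall x, Omega x -> 0 <= lambda x <= 1) ->
  measurable E -> E `<=` Omega ->
  forall APairing : sradon Omega, is_pairing_measure A divA lambda E APairing ->
  forall B : set 'rV[R]_N, measurable B -> B `<=` Omega ->
    sigma_finite B
      (fun X => hausdorff_measure (N%:R - q) (X `&` minus_boundary E)) ->
    radon_variation APairing B = 0%E.
Proof.
move=> N2 oO _ _ q1 qN pq DA _ l01 mE _ P EP B mB BO sB.
have q0 : 0 < q by exact: lt_trans q1.
have p0 : 0 < p.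
  rewrite -invr_gt0 (_ : p^-1 = 1 - q^-1); last by rewrite -pq addrK.
  by rewrite subr_gt0 invf_lt1.
have null m := @pairing_variation_eq0 _ _ _ _ _ _ _ oO p0 q0 qN pq DA _ _ _ l01 mE EP m B.
have pB : pos_variation P B = 0%E.
  by apply: null => // C; exact: pos_variation_eq0.
have nB : pos_variation (sradon_opp P) B = 0%E.
  by apply: null => // C; exact: pos_variation_opp_eq0.
have PF F : measurable F -> relatively_compact Omega F -> F `<=` B -> P F = 0%E.
  move=> mF rF FB; have [_ _ ->] := sradon_jordan P mF rF.
  have pF : pos_variation P F = 0%E.
    by apply/eqP; rewrite eq_le pos_variation_ge0 andbT -pB le_pos_variation.
  have nF : pos_variation (sradon_opp P) F = 0%E.
    by apply/eqP; rewrite eq_le pos_variation_ge0 andbT -nB le_pos_variation.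
  by rewrite pF nF subee.
have sF (F : (set 'rV[R]_N)^nat) :
    (forall i, measurable (F i) /\ relatively_compact Omega (F i)) ->
    B = \bigcup_i F i -> (\sum_(i <oo) `| P (F i) | = 0)%E.
  move=> mF BF; rewrite eseries0// => i _ _.
  have [mFi rFi] := mF i; rewrite PF ?abse0// BF.
  exact: bigcup_sup.
apply/eqP; rewrite eq_le; apply/andP; split.
  by apply: ge_ereal_sup => _ [F [mF _ BF] <-]; rewrite sF.
have [F [mF tF BF]] := exists_compact_partition oO mB BO.
by apply: ereal_sup_ubound; exists F => //; exact: sF.
Qed.
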